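(* A Le-diagram $L$ of type $(n,2n)$ parameterizes a unit interval positroid on $[2n]$ if and only if its shape is the $n\times n$ square and $L$ satisfies: (1) every column has exactly one plus except the last (rightmost) one, which has $n$ pluses; (2) the horizontal unit steps right below the bottom-most pluses are the horizontal steps of a length $2n$ Dyck path supported on the main diagonal of $L$.
   Context: A Le-diagram of type $(d,N)$ is a Young diagram (English notation, justified to the upper-left) contained in a $d\times(N-d)$ rectangle, whose boxes are filled with $0$'s and $+$'s so that no $0$ has simultaneously a $+$ above it in its column and a $+$ to its left in its row. A Le-diagram parameterizes the positroid whose associated decorated permutation $\pi$ is obtained as follows: replace each $+$ by an elbow joint (a pipe entering a box from the north exits east, one entering from the west exits south) and each $0$ by a cross (north exits south, west exits east); label the edges of the south-east border of the diagram, read as a path from the north-east corner of the rectangle to its south-west corner, by $1,\dots,N$; label each edge of the north and west border with the label of the opposite edge (same column, resp. same row); if the pipe entering at the boundary edge labeled $i$ exits at the edge labeled $j$, set $\pi(i)=j$; fixed points $j$ are marked clockwise if $j$ labels two horizontal edges and counterclockwise if it labels two vertical edges. The decorated permutation associated to a positroid $M$ of rank $d$ on $[N]$: with $I_i$ the lexicographically minimal basis w.r.t. $i<_i\dots<_i N<_i 1<_i\dots<_i i-1$, $\pi(j)=i$ if $I_{i+1}=(I_i\setminus\{i\})\cup\{j\}$, $j\ne i$, and $i$ fixed (clockwise if $i\notin I_i$, counterclockwise otherwise) if $I_{i+1}=I_i$. A unit interval positroid on $[2n]$: for a unit interval order $P$ on $n$ elements (a poset with a bijection $i\mapsto[q_i,q_i+1]$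 to unit intervals with $i<_P j$ iff $q_i+1<q_j$), labeled canonically (altitude $|\{j\le_P i\}|-|\{j\ge_P i\}|$ weakly increasing in the label, i.e. strictly smaller altitude implies smaller label), with antiadjacency matrix $A=(a_{i,j})$ ($a_{i,j}=0$ iff $i<_P j$, else $1$), it is the matroid on $[2n]$ of linearly independent $n$-sets of columns of the $n\times 2n$ matrix whose first $n$ columns are $I_n$ and whose column $n+j$ has entry $(-1)^{n-i}a_{n+1-i,j}$ in row $i$. *)

(* Defs.v *)
From HB Require Import structures.
From mathcomp Require Import all_boot all_order all_algebra all_fingroup.

Set Implicit Arguments.
Unset Strict Implicit.
Unset Printing Implicit Defensive.

Import Order.TTheory GRing.Theory Num.Theory.
Local Open Scope ring_scope.

(* Everything is indexed from 0: the ground set [N] is 'I_N, the posets live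
   on 'I_n, and rows, columns and boundary labels start at 0. *)

(** Decorated permutations *)

(* A fixed point outside [clockwise] is marked counterclockwise. *)
Record decorated_perm (N : nat) := DecoratedPerm {
  dperm :> {perm 'I_N};
  clockwise : {set 'I_N};
  clockwise_fixed : forall j, j \in clockwise -> dperm j = j
}.

(** Matroids, given by their sets of bases *)

Definition indep_columns (R : fieldType) (d N : nat) (B : 'M[R]_(d, N))
    (S : {set 'I_N}) : bool :=
  \rank (colsub (fun k : 'I_#|S| => enum_val k) B) == #|S|.

Definition column_matroid (R : fieldType) (d N : nat) (B : 'M[R]_(d, N)) :
    {set {set 'I_N}} :=
  [set S : {set 'I_N} | (#|S| == d) && indep_columns B S].

Definition positroid (R : realFieldType) (d N : nat)
    (M : {set {set 'I_N}}) : Prop :=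
  exists B : 'M[R]_(d, N),
    [/\ \rank B = d,
        forall f : 'I_d -> 'I_N,
          {homo f : x y / (x < y)%N} -> 0 <= \det (colsub f B)
      & M = column_matroid B].

(* The position of j in the order i <_i i+1 <_i ... <_i i-1. *)
Definition cyc_pos (N : nat) (i j : 'I_N) : nat := ((j + N - i) %% N)%N.

Definition cyc_word (N : nat) (i : 'I_N) (S : {set 'I_N}) : seqlexi nat :=
  sort leq [seq cyc_pos i j | j <- enum S].

Definition lex_min_basis (N : nat) (M : {set {set 'I_N}}) (i : 'I_N)
    (S : {set 'I_N}) : Prop :=
  S \in M /\ forall T, T \in M -> (cyc_word i S <= cyc_word i T)%O.

(* [ordS] is the cyclic successor, so I_{N+1} is read as I_1.  The guard
   I_{i+1} <> I_i is needed because, when i is a loop,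
   I_{i+1} = (I_i \ {i}) U {j} holds for every j in I_i. *)
Definition matroid_dperm (N : nat) (M : {set {set 'I_N}})
    (p : decorated_perm N) : Prop :=
  exists2 I : 'I_N -> {set 'I_N},
    forall i, lex_min_basis M i (I i)
  & forall i,
      (I (ordS i) = I i -> p i = i /\ (i \in clockwise p) = (i \notin I i)) /\
      (I (ordS i) <> I i ->
         forall j, j != i -> I (ordS i) = j |: (I i :\ i) -> p j = i).

(** Le-diagrams *)

(* [rows] lists the rows of the filling, [true] standing for + and [false]
   for 0; the r-th row of the Young diagram has [size (nth [::] rows r)]
   boxes.  Rows may be empty, but there are exactly d of them. *)
Definition is_box (rows : seq (seq bool)) (r c : nat) : bool :=
  (c < size (nth [::] rows r))%N.

Definition is_plus (rows : seq (seq bool)) (r c : nat) : bool :=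
  nth false (nth [::] rows r) c.

(* A Le-diagram of type (d, d + m). *)
Record le_diagram (d m : nat) := LeDiagram {
  le_rows :> d.-tuple (seq bool);
  le_fits : forall r, (size (nth [::] le_rows r) <= m)%N;
  le_young : sorted geq (shape le_rows);
  le_rule : forall r c r' c', is_box le_rows r c -> (r' < r)%N -> (c' < c)%N ->
    is_plus le_rows r' c -> is_plus le_rows r c' -> is_plus le_rows r c
}.

(* [Vert r c] is the west edge and [Horiz r c] the north edge of cell (r, c);
   pipes travel through these edges eastwards and southwards respectively. *)
Inductive edge := Vert of nat & nat | Horiz of nat & nat.

Definition is_horiz (e : edge) : bool := if e is Horiz _ _ then true else false.

Definition edge_in (rows : seq (seq bool)) (e : edge) : bool :=
  match e with Vert r c | Horiz r c => is_box rows r c end.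

Definition edge_next (rows : seq (seq bool)) (e : edge) : edge :=
  match e with
  | Vert r c => if is_plus rows r c then Horiz r.+1 c else Vert r c.+1
  | Horiz r c => if is_plus rows r c then Vert r c.+1 else Horiz r.+1 c
  end.

Inductive pipe (rows : seq (seq bool)) : edge -> edge -> Prop :=
| pipe_exit e : ~~ edge_in rows e -> pipe rows e e
| pipe_box e f : edge_in rows e -> pipe rows (edge_next rows e) f ->
    pipe rows e f.

Definition entry_edge (d m : nat) (e : edge) : bool :=
  match e with
  | Vert r c => (r < d)%N && (c == 0%N)
  | Horiz r c => (r == 0%N) && (c < m)%N
  end.

(* The label of an edge is the position, on the south-east border read from
   the north-east to the south-west corner of the d x m rectangle, of the
   border step in the same row (resp. column): the number of horizontal border
   steps to the right plus the number of vertical border steps above. *)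
Definition edge_label (m : nat) (rows : seq (seq bool)) (e : edge) : nat :=
  match e with
  | Vert r _ => (r + (m - size (nth [::] rows r)))%N
  | Horiz _ c => (m - c.+1 + count (fun row => c < size row)%N rows)%N
  end.

Definition le_dperm (d m : nat) (L : le_diagram d m)
    (p : decorated_perm (d + m)) : Prop :=
  forall (e f : edge) (i j : 'I_(d + m)),
    entry_edge d m e -> pipe L e f ->
    edge_label m L e = i -> edge_label m L f = j ->
    p i = j /\ (i = j -> (i \in clockwise p) = is_horiz e).

Definition parameterizes (R : realFieldType) (d m : nat) (L : le_diagram d m)
    (M : {set {set 'I_(d + m)}}) : Prop :=
  positroid R d M /\
  exists2 p : decorated_perm (d + m), le_dperm L p & matroid_dperm M p.

(** Unit interval orders, as strict orders lt on 'I_n *)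

Definition unit_interval_order (R : realFieldType) (n : nat)
    (lt : rel 'I_n) : Prop :=
  [/\ irreflexive lt, transitive lt
    & exists2 q : 'I_n -> R, injective q & forall i j, lt i j = (q i + 1 < q j)].

Definition altitude (n : nat) (lt : rel 'I_n) (i : 'I_n) : int :=
  #|[set j | (j == i) || lt j i]|%:Z - #|[set j | (j == i) || lt i j]|%:Z.

Definition canonically_labeled (n : nat) (lt : rel 'I_n) : Prop :=
  forall i j, altitude lt i < altitude lt j -> (i < j)%N.

Definition antiadjacency (R : realFieldType) (n : nat) (lt : rel 'I_n) :
    'M[R]_n :=
  \matrix_(i, j) (if lt i j then 0 else 1).

(* With 0-based rows, [rev_ord i] has value n - 1 - i, which is both the
   exponent of the sign and the row of A that is used. *)
Definition uip_matrix (R : realFieldType) (n : nat) (A : 'M[R]_n) :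
    'M[R]_(n, n + n) :=
  row_mx 1%:M (\matrix_(i, j) ((-1) ^+ rev_ord i * A (rev_ord i) j)).

Definition unit_interval_positroid (R : realFieldType) (n : nat)
    (M : {set {set 'I_(n + n)}}) : Prop :=
  exists lt : rel 'I_n,
    [/\ unit_interval_order R lt, canonically_labeled lt
      & M = column_matroid (uip_matrix (antiadjacency R lt))].

(** Dyck paths *)

(* A path from the north-west to the south-east corner of the n x n square;
   [true] is a unit step east, [false] a unit step south.  It stays weakly
   below the main diagonal of the square. *)
Definition dyck_path (n : nat) (w : seq bool) : Prop :=
  [/\ size w = (2 * n)%N, count id w = n
    & forall k, (count id (take k w) <= count negb (take k w))%N].

(* w has a horizontal step spanning column c at distance h from the top. *)
Definition horizontal_step (w : seq bool) (h c : nat) : Prop :=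
  exists k, [/\ nth false w k, count negb (take k w) = h
              & count id (take k w) = c].

Definition bottom_plus (rows : seq (seq bool)) (r c : nat) : Prop :=
  is_plus rows r c /\ forall r', (r < r')%N -> ~~ is_plus rows r' c.

Definition square_shape (n : nat) (L : le_diagram n n) : Prop :=
  shape L = nseq n n.

Definition column_condition (n : nat) (L : le_diagram n n) : Prop :=
  forall c, (c < n)%N ->
    count (fun row => nth false row c) L = (if c.+1 == n then n else 1%N).

Definition dyck_condition (n : nat) (L : le_diagram n n) : Prop :=
  exists2 w : seq bool, dyck_path n w
  & forall h c, horizontal_step w h c <->
      (exists2 r, h = r.+1 & bottom_plus L r c).

(* Main.v *)
Require Import Defs.
From mathcomp Require Import all_boot all_order all_algebra all_fingroup.
From mathcomp Require Import zify lra.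

(** Let s j be the row of the bottom-most plus of the column with boundary label
    n + j.  The Dyck condition says that s is weakly decreasing and stays weakly
    below the diagonal, and canonically labelled unit interval orders are exactly
    the relations "i <_P j iff s j < n - 1 - i" for such s.  In the matrix of the
    positroid, column n + j is then an alternating sum of the first s j + 1 unit
    vectors; after taking differences of adjacent rows this is the matroid of a
    path on n + 1 vertices together with one chord per j joining a vertex to the
    end of the path.  The lexicographically minimal bases are explicit spanning
    trees, and consecutive ones differ by a single exchange, which gives the
    decorated permutation in closed form.  Following the pipes of the diagram
    with pluses (s j, n - 1 - j) and a full last column yields the same
    permutation.  Conversely, since the permutation has no fixed points, the
    Le-rule forces the last column to be full; a pipe reaching that column from
    the west in row r then leaves in row r + 1, and with this the remaining
    columns can be read off the permutation from left to right. *)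

Set Implicit Arguments.
Unset Strict Implicit.
Unset Printing Implicit Defensive.

Import Order.TTheory GRing.Theory Num.Theory.
Local Open Scope ring_scope.

(** * Unit interval orders as staircases *)

(** The first condition is both irreflexivity of the order and the path staying below the diagonal;
    with the second it forces [s 0 = n - 1] when [n > 0]. *)
Definition stair (n : nat) (s : nat -> nat) : Prop :=
  [/\ forall j, (j < n -> n <= s j + j.+1)%N,
      forall j, (j < n -> s j < n)%N
    & forall j k, (j <= k -> k < n -> s k <= s j)%N].

Definition stair_matrix (R : realFieldType) n (s : nat -> nat) :
    'M[R]_(n, n + n) :=
  \matrix_(a < n, x < (n + n)%N) if (x < n)%N then (a == x :> nat)%N%:R
                 else (-1) ^+ (n - a.+1)%N * (a <= s (x - n))%N%:R.

Lemma card_ord_lt n m : (m <= n)%N -> #|[set x : 'I_n | (x < m)%N]| = m.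
Proof.
by move=> le_mn; rewrite -sum1dep_card (big_ord_narrow le_mn) sum1_card card_ord.
Qed.

Lemma mem_down_closed n (D : {set 'I_n}) (i : 'I_n) :
  (forall x y : 'I_n, (x <= y)%N -> y \in D -> x \in D) ->
  (i \in D) = (i < #|D|)%N.
Proof.
move=> downD; apply/idP/idP => [Di|].
  rewrite -[in X in (X <= _)%N](card_ord_lt (ltn_ord i)).
  by apply/subset_leq_card/subsetP => x; rewrite inE ltnS => /downD; apply.
apply: contraLR => nDi; rewrite -leqNgt -[leqRHS](card_ord_lt (ltnW (ltn_ord i))).
apply/subset_leq_card/subsetP => x Dx; rewrite inE ltnNge.
by apply: contra nDi => /downD; apply.
Qed.

Lemma altitudeE n (lt : rel 'I_n) (i : 'I_n) : irreflexive lt ->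
  altitude lt i = #|[set j | lt j i]|%:Z - #|[set j | lt i j]|%:Z.
Proof.
move=> irr; rewrite /altitude.
have -> : [set j | (j == i) || lt j i] = i |: [set j | lt j i].
  by apply/setP => j; rewrite !inE.
have -> : [set j | (j == i) || lt i j] = i |: [set j | lt i j].
  by apply/setP => j; rewrite !inE.
by rewrite !cardsU1 !inE irr /= !add1n; lia.
Qed.

(** When [q x <= q y], the down-set of [x] lies in that of [y] and the up-set of [y] in that of [x];
    if the altitude of [y] does not exceed that of [x], both inclusions are equalities. Hence labels
    can disagree with the order of the coordinates only for elements having the same relations. *)
Lemma canonical_mono (R : realFieldType) n (lt : rel 'I_n) :
  unit_interval_order R lt -> canonically_labeled lt ->
  forall i i' j j' : 'I_n, (i' <= i)%N -> (j <= j')%N -> lt i j -> lt i' j'.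
Proof.
move=> [irr _ [q _ ltq]] can.
have alt_le (i i' : 'I_n) : (i' <= i)%N -> altitude lt i' <= altitude lt i.
  by rewrite !leNgt; apply: contraL => /can; rewrite -ltnNge.
have eqalt (x y : 'I_n) : q x <= q y -> altitude lt y <= altitude lt x ->
    (forall z, lt x z = lt y z) /\ (forall z, lt z x = lt z y).
  move=> le_q; rewrite !altitudeE //.
  have sD : [set z | lt z x] \subset [set z | lt z y].
    by apply/subsetP => z; rewrite !inE !ltq => /lt_le_trans; apply.
  have sU : [set z | lt y z] \subset [set z | lt x z].
    by apply/subsetP => z; rewrite !inE !ltq; apply: le_lt_trans; rewrite lerD2r.
  move: (subset_leq_card sD) (subset_leq_card sU) => cD cU le_alt.
  have /eqP/setP eD : [set z | lt z x] == [set z | lt z y].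
    by rewrite eqEcard sD /=; move: cD cU le_alt; do 4 move: #|_|; lia.
  have /eqP/setP eU : [set z | lt y z] == [set z | lt x z].
    by rewrite eqEcard sU /=; move: cD cU le_alt; do 4 move: #|_|; lia.
  by split=> z; [have := eU z | have := eD z]; rewrite !inE.
move=> i i' j j' le_i le_j lt_ij.
have lt_i'j : lt i' j.
  case: (leP (q i') (q i)) => [le_q | /ltW le_q].
    by move: lt_ij; rewrite !ltq; apply: le_lt_trans; rewrite lerD2r.
  by have [<- _] := eqalt _ _ le_q (alt_le _ _ le_i).
case: (leP (q j) (q j')) => [le_q | /ltW le_q].
  by move: lt_i'j; rewrite !ltq => /lt_le_trans; apply.
by have [_ ->] := eqalt _ _ le_q (alt_le _ _ le_j).
Qed.

Lemma unit_interval_stair (R : realFieldType) n (lt : rel 'I_n) :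
  unit_interval_order R lt -> canonically_labeled lt ->
  exists2 s, stair n s & forall i j : 'I_n, lt i j = (s j + i.+1 < n)%N.
Proof.
move=> uio can; have mono := canonical_mono uio can.
case: uio => irr _ _.
(* Using every label up to [m] defines [D] on all natural numbers and makes it increasing; for
   [m < n], monotonicity identifies it with the down-set of [m], an initial segment. *)
pose D m := [set i : 'I_n | [exists j : 'I_n, (j <= m)%N && lt i j]].
have ltD (i j : 'I_n) : lt i j = (i < #|D j|)%N.
  rewrite -mem_down_closed => [|x y le_xy]; rewrite !inE.
    apply/idP/existsP => [lij | [j' /andP [le_j]]]; last exact: mono.
    by exists j; rewrite leqnn.
  by case/existsP=> z /andP [le_z lyz]; apply/existsP; exists z; rewrite le_z (mono y _ z).
have Dn m : (m < n)%N -> (#|D m| <= m)%N.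
  move=> lt_mn; rewrite leqNgt -[X in (X < _)%N]/(val (Ordinal lt_mn)).
  by rewrite -(ltD (Ordinal lt_mn) (Ordinal lt_mn)) irr.
exists (fun m => n.-1 - #|D m|)%N; last first.
  by move=> i j; rewrite ltD; have := Dn _ (ltn_ord j); have := ltn_ord j; lia.
split=> [j lt_jn | j lt_jn | j k le_jk _]; first by have := Dn _ lt_jn; lia.
  by lia.
apply: leq_sub2l; apply/subset_leq_card/subsetP => i; rewrite !inE.
case/existsP=> z /andP [le_z lyz]; apply/existsP; exists z.
by rewrite (leq_trans le_z).
Qed.

(* Here g j counts the elements below j.  Coordinates are added one at a time:
   the new one must lie above q (g j - 1) + 1 and below q (g j) + 1. *)
Lemma unit_interval_coordinates (R : realFieldType) n (g : nat -> nat) :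
  (forall j, j < n -> g j <= j)%N ->
  (forall j k, j <= k -> k < n -> g j <= g k)%N ->
  forall m, (m <= n)%N -> exists q : nat -> R,
    [/\ forall i j, (i < j)%N -> (j < m)%N -> q i < q j,
        forall i j, (i < m)%N -> (j < m)%N -> (q i + 1 < q j) = (i < g j)%N
      & forall i j, (i < m)%N -> (j < m)%N -> q j != q i + 1].
Proof.
move=> g_le g_mono; elim=> [|m IHm] lt_mn; first by exists (fun=> 0); split.
have [q [q_mono q_g q_neq]] := IHm (ltnW lt_mn).
have q_le i j : (i <= j)%N -> (j < m)%N -> q i <= q j.
  by rewrite leq_eqVlt => /predU1P [-> // | lt_ij] lt_jm; exact/ltW/q_mono.
have gm := g_le _ lt_mn.
have [v [v_gt v_gt1 v_lt]] : exists v, [/\ forall i, (i < m)%N -> q i < v,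
    forall i, (i < g m)%N -> q i + 1 < v
  & forall i, (g m <= i)%N -> (i < m)%N -> v < q i + 1].
  case: m => [|m] in lt_mn q_mono q_g q_neq q_le gm {IHm} *.
    by exists 0; split=> // i; lia.
  pose lo := if g m.+1 == 0%N then q m else Num.max (q m) (q (g m.+1).-1 + 1).
  have lo1 i : (i < m.+1)%N -> q i <= lo.
    move=> lt_im; apply: (@le_trans _ _ (q m)); first exact: q_le.
    by rewrite /lo; case: ifP; rewrite // le_max lexx.
  have lo2 i : (i < g m.+1)%N -> q i + 1 <= lo.
    move=> lt_ig; rewrite /lo gtn_eqF ?(leq_ltn_trans _ lt_ig) // le_max.
    by apply/orP; right; rewrite lerD2r q_le //; lia.
  have [eq_gm | neq_gm] := eqVneq (g m.+1) m.+1.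
    exists (lo + 1); split=> [i /lo1 | i /lo2 | i]; [lra | lra |].
    by rewrite eq_gm; lia.
  have lt_gm : (g m.+1 < m.+1)%N by rewrite ltn_neqAle neq_gm.
  have lo_hi : lo < q (g m.+1) + 1.
    (* Strictness comes from the third invariant, that no two coordinates differ by exactly 1; it
       leaves room for a midpoint. *)
    have qm : q m < q (g m.+1) + 1.
      rewrite lt_neqAle q_neq //= leNgt q_g // -leqNgt.
      exact: g_mono.
    rewrite /lo; case: ifP => // g0; rewrite gt_max qm /= ltrD2r q_mono //; lia.
  exists ((lo + (q (g m.+1) + 1)) / 2); split=> [i /lo1 | i /lo2 | i le_gi lt_im].
  - lra.
  - lra.
  - by have := q_le _ _ le_gi lt_im; lra.
have ltSP i : (i < m.+1)%N -> i = m \/ (i < m)%N by lia.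
exists (fun i => if i == m then v else q i); split=> i j.
- move=> lt_ij /ltSP [eq_j | lt_jm].
    by rewrite eq_j eqxx ltn_eqF -?eq_j //; apply: v_gt; rewrite -eq_j.
  by rewrite !ltn_eqF // ?q_mono // (ltn_trans lt_ij).
- move=> /ltSP [-> | lt_im] /ltSP [-> | lt_jm].
  + by rewrite eqxx [RHS]ltnNge gm /=; lra.
  + rewrite eqxx ltn_eqF //.
    have -> : (m < g j)%N = false.
      by apply/negbTE; have := g_le j (ltn_trans lt_jm lt_mn); lia.
    by have := v_gt _ lt_jm; lra.
  + rewrite eqxx ltn_eqF //; case: ltnP => [/v_gt1 -> // | le_gi].
    by have := v_lt _ le_gi lt_im; lra.
  + by rewrite !ltn_eqF // q_g.
- move=> /ltSP [-> | lt_im] /ltSP [-> | lt_jm].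
  + by rewrite eqxx; apply/eqP; lra.
  + by rewrite eqxx ltn_eqF //; have := v_gt _ lt_jm; apply: contraTneq; lra.
  + rewrite eqxx ltn_eqF //; case: (ltnP i (g m)) => [/v_gt1 | le_gi].
      by apply: contraTneq; lra.
    by have := v_lt _ le_gi lt_im; apply: contraTneq; lra.
  + by rewrite !ltn_eqF // q_neq.
Qed.

(** Down-sets grow and up-sets shrink with the label, so the altitude is weakly increasing and the
    labelling canonical. *)
Lemma stair_unit_interval (R : realFieldType) n s : stair n s ->
  exists lt : rel 'I_n,
    [/\ unit_interval_order R lt, canonically_labeled lt
      & forall i j : 'I_n, lt i j = (s j + i.+1 < n)%N].
Proof.
case=> sn s_lt s_mono.
have [j lt_jn|j k le_jk lt_kn|q [q_mono q_g _]] :=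
    unit_interval_coordinates R (g := fun j => (n.-1 - s j)%N) _ _ (leqnn n).
- by have := sn _ lt_jn; lia.
- by have := s_mono _ _ le_jk lt_kn; lia.
exists (fun i j => q i + 1 < q j).
have ltE (i j : 'I_n) : (q i + 1 < q j) = (s j + i.+1 < n)%N.
  by rewrite q_g //; have := s_lt _ (ltn_ord j); lia.
have irr : irreflexive (fun i j : 'I_n => q i + 1 < q j).
  by move=> i; lra.
split=> //.
  split=> //; first by move=> y x z /= xy; apply/lt_trans/(lt_trans xy); rewrite ltrDl.
  exists (fun i : 'I_n => q i) => [i j eq_q|]; last by [].
  case: (ltngtP i j) => [/q_mono /(_ (ltn_ord j)) | /q_mono /(_ (ltn_ord i)) |].
  - by rewrite eq_q ltxx.
  - by rewrite eq_q ltxx.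
  - exact: val_inj.
move=> i j; rewrite !altitudeE // => lt_alt.
rewrite ltnNge; apply/negP => le_ji; move: lt_alt; apply/negP; rewrite -leNgt.
have sub1 : [set x : 'I_n | q x + 1 < q j] \subset [set x : 'I_n | q x + 1 < q i].
  apply/subsetP => x; rewrite !inE !ltE.
  by have := s_mono _ _ le_ji (ltn_ord i); lia.
have sub2 : [set x : 'I_n | q i + 1 < q x] \subset [set x : 'I_n | q j + 1 < q x].
  by apply/subsetP => x; rewrite !inE !ltE; lia.
by move: (subset_leq_card sub1) (subset_leq_card sub2); do 4 move: #|_|; lia.
Qed.

(** Row [a] uses the element [i = n - 1 - a], for which [s j + i.+1 < n] becomes [s j < a]. *)
Lemma uip_matrix_stair (R : realFieldType) n (lt : rel 'I_n) (s : nat -> nat) :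
  (forall i j : 'I_n, lt i j = (s j + i.+1 < n)%N) -> stair n s ->
  uip_matrix (antiadjacency R lt) = stair_matrix R n s.
Proof.
move=> ltE [_ s_lt _]; apply/matrixP => a x; rewrite !mxE.
case: splitP => j xj; rewrite !mxE xj // addKn ltE /=.
have -> : (s j + (n - a.+1).+1 < n)%N = ~~ (a <= s j)%N.
  by have := s_lt _ (ltn_ord j); have := ltn_ord a; lia.
by case: leqP.
Qed.

Lemma unit_interval_positroidP (R : realFieldType) n (M : {set {set 'I_(n + n)}}) :
  unit_interval_positroid R M <->
  exists2 s, stair n s & M = column_matroid (stair_matrix R n s).
Proof.
split=> [[lt [uio can ->]] | [s st ->]].
  have [s st ltE] := unit_interval_stair uio can.
  by exists s => //; rewrite (uip_matrix_stair _ ltE).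
have [lt [uio can ltE]] := stair_unit_interval R st.
by exists lt; split=> //; rewrite (uip_matrix_stair _ ltE).
Qed.

(** * Nonnegativity of the maximal minors *)

(* Columns t < a are unit vectors and the others are alternating staircase
   columns.  A unit column in row p can be expanded away: the p rows above p
   change sign, which cancels the cofactor sign.  Once no unit column is left,
   either the last column has at most one nonzero entry, or the first two rows
   are opposite. *)
Lemma det_identity_staircase_ge0 (R : realFieldType) m a (x rho sigma : 'I_m -> nat) :
  (forall t u : 'I_m, (t < u)%N -> (u < a)%N -> (x t < x u)%N) ->
  {homo rho : i j / (i <= j)%N} ->
  (forall t u : 'I_m, (t <= u)%N -> (sigma u <= sigma t)%N) ->
  0 <= \det (\matrix_(i < m, t < m)
    if (t < a)%N then (i == x t :> nat)%N%:R
    else (-1) ^+ (m - i.+1)%N * (rho i <= sigma t)%N%:R : R).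
Proof.
elim: m a x rho sigma => [|m IHm] a x rho sigma x_mono rho_mono sigma_mono.
  by rewrite det_mx00.
set A := \matrix_(i, t) _.
have [a0|a_gt0] := posnP a.
  have AE i t : A i t = (-1) ^+ (m - i)%N * (rho i <= sigma t)%N%:R.
    by rewrite mxE a0 subSS.
  have [le_0|lt_0] := leqP (rho ord0) (sigma ord_max); last first.
    suff -> : \det A = 0 by [].
    rewrite (expand_det_col A ord_max) big1 // => i _.
    rewrite AE leqNgt (leq_trans lt_0 (rho_mono _ _ _)) ?leq0n //.
    by rewrite mulr0 mul0r.
  have [/existsP [i /andP [i_gt0 le_i]]|no_i] :=
      boolP [exists i, (i != ord0) && (rho i <= sigma ord_max)%N].
    suff -> : \det A = 0 by [].
    apply/eqP/det0P.
    have m_gt0 : (0 < m)%N.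
      by move: i_gt0 (ltn_ord i); rewrite -val_eqE /=; lia.
    pose one := lift ord0 (Ordinal m_gt0).
    exists (delta_mx 0 ord0 + delta_mx 0 one).
      apply/eqP => /matrixP /(_ 0 ord0); rewrite !mxE eqxx.
      by rewrite (negbTE (neq_lift _ _)) /= addr0; apply/eqP; rewrite oner_eq0.
    rewrite mulmxDl -!rowE; apply/rowP => t; rewrite !mxE a0 /=.
    have le_t : (sigma ord_max <= sigma t)%N by apply: sigma_mono; rewrite -ltnS.
    have -> : (rho ord0 <= sigma t)%N by apply: leq_trans le_t.
    have -> : (rho one <= sigma t)%N.
      apply: leq_trans le_t; apply: leq_trans le_i; apply: rho_mono.
      by move: i_gt0; rewrite -val_eqE /= /bump /=; lia.
    have -> : (m.+1 - 1 = (m.+1 - (bump 0 0).+1).+1)%N by rewrite /bump /=; lia.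
    by rewrite !mulr1 exprS mulN1r addNr.
  rewrite (expand_det_col A ord_max) (bigD1 ord0) //= big1 ?addr0; last first.
    move=> i i_neq0; rewrite AE; case: leqP => [le_i|]; last by rewrite mulr0 mul0r.
    by case/existsP: no_i; exists i; rewrite i_neq0.
  rewrite AE le_0 subn0 mulr1 /cofactor add0n mulrA -expr2 sqrr_sign mul1r.
  have -> : row' ord0 (col' ord_max A) = \matrix_(i < m, t < m)
      if (t < 0)%N then (i == 0%N :> nat)%N%:R
      else (-1) ^+ (m - i.+1)%N *
        (rho (lift ord0 i) <= sigma (lift ord_max t))%N%:R : R.
    by apply/matrixP => i t; rewrite !mxE a0 /= subSS.
  apply: (IHm 0%N (fun=> 0%N) (rho \o lift ord0) (sigma \o lift ord_max)) => //.
    by move=> i j le_ij; apply: rho_mono.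
  by move=> t u le_tu; apply: sigma_mono; rewrite !lift_max.
(* A unit column whose index lies outside the matrix is zero. *)
have [lt_p|ge_p] := ltnP (x ord0) m.+1; last first.
  suff -> : \det A = 0 by [].
  rewrite (expand_det_col A ord0) big1 // => i _.
  by rewrite mxE a_gt0 ltn_eqF ?mul0r // (leq_trans (ltn_ord i)).
have [p p_val] : exists p : 'I_m.+1, x ord0 = p by exists (Ordinal lt_p).
rewrite (expand_det_col A ord0) (bigD1 p) //= big1 ?addr0; last first.
  by move=> i; rewrite -val_eqE mxE a_gt0 /= p_val => /negbTE ->; rewrite mul0r.
rewrite mxE a_gt0 p_val eqxx mul1r /cofactor addn0.
have x_gt (t : 'I_m) : (t < a.-1)%N -> (p < x (lift ord0 t))%N.
  by move=> lt_t; rewrite -p_val; apply: x_mono => //=; rewrite /bump; lia.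
pose B := \matrix_(i < m, t < m)
  if (t < a.-1)%N then (i == unbump p (x (lift ord0 t)) :> nat)%N%:R
  else (-1) ^+ (m - i.+1)%N * (rho (lift p i) <= sigma (lift ord0 t))%N%:R : R.
(* Deleting row [p] brings the rows above it one step closer to the last row, which flips their
   sign; the rows below keep their distance. *)
pose d := \row_(i < m) (if (i < p)%N then -1 else 1 : R).
have -> : row' p (col' ord0 A) = diag_mx d *m B.
  suff BE (i t : 'I_m) : row' p (col' ord0 A) i t = (diag_mx d *m B) i t.
    by apply/matrixP => i t; exact: BE.
  rewrite mul_diag_mx !mxE /=.
  have -> : (bump 0 t < a)%N = (t < a.-1)%N by rewrite /bump; lia.
  case: ifP => [/x_gt gt_p|_].
    rewrite /bump /unbump; case: (ltnP i p) => [lt_ip|le_pi].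
      rewrite !ltn_eqF ?mulr0 ?gt_p ?subn1 //; last exact: ltn_trans gt_p.
      by apply: (leq_trans lt_ip); rewrite -ltnS (ltn_predK gt_p).
    by rewrite mul1r gt_p subn1 -[in LHS](ltn_predK gt_p) add1n eqSS.
  rewrite mulrA; congr (_ * _); rewrite /bump.
  case: (ltnP i p) => [lt_ip|le_pi]; last by rewrite mul1r add1n subSS.
  by rewrite add0n subSS -exprS; congr (_ ^+ _); have := ltn_ord i; lia.
have det_d : \det (diag_mx d) = (-1) ^+ p.
  rewrite det_diag (eq_bigr (fun i : 'I_m => if (i < p)%N then -1 else 1)); last first.
    by move=> i _; rewrite mxE.
  rewrite -big_mkcond /= prodr_const; congr (_ ^+ _).
  have le_pm : (p <= m)%N by rewrite -ltnS.
  by rewrite -[RHS](card_ord_lt le_pm) cardsE.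
rewrite det_mulmx det_d mulrA -expr2 sqrr_sign mul1r.
apply: (IHm a.-1 (fun t => unbump p (x (lift ord0 t))) (rho \o lift p) (sigma \o lift ord0)).
- move=> t u lt_tu lt_ua.
  have := x_gt _ lt_ua; have := x_gt _ (ltn_trans lt_tu lt_ua).
  have := x_mono (lift ord0 t) (lift ord0 u); rewrite /= /bump /unbump /=.
  by lia.
- by move=> i j le_ij; apply: rho_mono; rewrite /= /bump; lia.
- by move=> t u le_tu; apply: sigma_mono; rewrite /= /bump; lia.
Qed.

Lemma stair_matrix_rank (R : realFieldType) n s : \rank (stair_matrix R n s) = n.
Proof.
apply/eqP; rewrite eqn_leq rank_leq_row /=.
rewrite -[X in (X <= _)%N](mxrank1 R n); set M := stair_matrix R n s.
suff <- : M *m col_mx 1%:M 0 = 1%:M by exact: mxrankM_maxl.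
rewrite -[M]hsubmxK mul_row_col mulmx1 mulmx0 addr0.
by apply/matrixP => i j; rewrite !mxE /= ltn_ord.
Qed.

Lemma stair_matrix_positroid (R : realFieldType) n s : stair n s ->
  positroid R n (column_matroid (stair_matrix R n s)).
Proof.
case=> _ _ s_mono; exists (stair_matrix R n s); split=> //.
  exact: stair_matrix_rank.
move=> f f_mono.
(* Since [f] is increasing, the selected unit columns come first, and [a] counts them. *)
pose a := #|[set t | (f t < n)%N]|.
have f_le (t u : 'I_n) : (t <= u)%N -> (f t <= f u)%N.
  by rewrite leq_eqVlt => /predU1P [/val_inj -> // | /f_mono /ltnW].
have lt_a (t : 'I_n) : (t < a)%N = (f t < n)%N.
  rewrite -mem_down_closed ?inE // => u v le_uv; rewrite !inE.
  exact/leq_ltn_trans/f_le.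
have -> : colsub f (stair_matrix R n s) = \matrix_(i < n, t < n)
    if (t < a)%N then (i == f t :> nat)%N%:R
    else (-1) ^+ (n - i.+1)%N * (i <= s (f t - n))%N%:R.
  by apply/matrixP => i t; rewrite !mxE lt_a.
apply: (@det_identity_staircase_ge0 R n a (fun t => f t) (fun i => i)
          (fun t => s (f t - n)%N)) => //.
  by move=> t u lt_tu _; apply: f_mono.
by move=> t u /f_le le_f; apply: s_mono; have := ltn_ord (f u); lia.
Qed.

(** * Lexicographically minimal bases *)

Lemma cyc_posE N (i j : 'I_N) :
  cyc_pos i j = if (i <= j)%N then (j - i)%N else (j + N - i)%N.
Proof.
have [lt_i lt_j] := (ltn_ord i, ltn_ord j); rewrite /cyc_pos.
case: leqP => le_ij; last by rewrite modn_small //; lia.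
by rewrite addnC -addnBA // modnDl modn_small //; lia.
Qed.

Lemma cyc_pos_inj N (i : 'I_N) : injective (cyc_pos i).
Proof.
move=> j k; rewrite !cyc_posE => eq_jk; apply: val_inj => /=.
have [lt_j lt_k] := (ltn_ord j, ltn_ord k); have lt_i := ltn_ord i.
by move: eq_jk; case: (leqP i j); case: (leqP i k); lia.
Qed.

Lemma mem_cyc_word N (i j : 'I_N) S : (cyc_pos i j \in (cyc_word i S : seq nat)) = (j \in S).
Proof. by rewrite mem_sort (mem_map (@cyc_pos_inj _ i)) mem_enum. Qed.

Lemma size_cyc_word N (i : 'I_N) S : size (cyc_word i S) = #|S|.
Proof. by rewrite size_sort size_map -cardE. Qed.

Lemma sorted_cyc_word N (i : 'I_N) S : sorted leq (cyc_word i S).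
Proof. exact/sort_sorted/leq_total. Qed.

Lemma uniq_cyc_word N (i : 'I_N) S : uniq (cyc_word i S).
Proof. by rewrite sort_uniq map_inj_uniq ?enum_uniq //; apply: cyc_pos_inj. Qed.

Lemma lex_min_basis_uniq N (M : {set {set 'I_N}}) i S T :
  lex_min_basis M i S -> lex_min_basis M i T -> S = T.
Proof.
move=> [MS minS] [MT minT]; have eqST : cyc_word i S = cyc_word i T.
  by apply/le_anti; rewrite minS ?minT.
by apply/setP => j; rewrite -!(mem_cyc_word i) eqST.
Qed.

Lemma ltxi_first_diff (u v : seqlexi nat) : size u = size v -> (u < v)%O ->
  exists k, [/\ (k < size u)%N, take k u = take k v & (nth 0 u k < nth 0 v k)%N].
Proof.
elim: u v => [|a u IHu] [|b v] //= [eq_sz]; rewrite ltxi_cons leEnat.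
case/andP; rewrite leq_eqVlt => /predU1P [<- | lt_ab _]; last by exists 0%N; split.
rewrite leqnn /= => /(IHu _ eq_sz) [k [lt_k eq_tk lt_nth]].
by exists k.+1; split=> //=; rewrite eq_tk.
Qed.

Lemma sorted_mem_take (w : seq nat) a k :
  sorted leq w -> (k < size w)%N -> a \in w -> (a < nth 0 w k)%N -> a \in take k w.
Proof.
move=> sorted_w lt_k w_a lt_a; have lt_idx : (index a w < size w)%N by rewrite index_mem.
rewrite in_take_leq ?(ltnW lt_k) // ltnNge; apply/negP => le_k.
move: lt_a; rewrite ltnNge -[X in (_ <= X)%N](nth_index 0%N w_a).
by rewrite (sorted_leq_nth leq_trans leqnn).
Qed.

Lemma indep_columns_eq0 (R : fieldType) d N (B : 'M[R]_(d, N)) (S : {set 'I_N})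
    (v : 'cV_N) :
  indep_columns B S -> (forall y, v y 0 != 0 -> y \in S) -> B *m v = 0 -> v = 0.
Proof.
move=> /eqP rankS suppv Bv0; set C := colsub _ _ in rankS.
pose w := rowsub (fun k : 'I_#|S| => enum_val k) v.
have Cw0 : C *m w = 0.
  rewrite -Bv0; apply/colP => i; rewrite !mxE [RHS](bigID (mem S)) /=.
  rewrite [X in _ + X]big1 ?addr0 => [|y]; last first.
    by move=> nSy; rewrite (contraNeq (suppv y)) ?mulr0.
  by rewrite [RHS]big_enum_val; apply: eq_bigr => k _; rewrite !mxE.
have w0 : w = 0.
  apply: trmx_inj; apply/eqP; rewrite trmx0 -(@mulmx_free_eq0 _ _ _ _ _ C^T).
    by rewrite -trmx_mul Cw0 trmx0.
  by rewrite /row_free mxrank_tr rankS.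
apply/colP => y; rewrite mxE; apply/eqP/negPn/negP => v_y.
have Sy := suppv _ v_y; case/eqP: v_y.
move/colP/(_ (enum_rank_in Sy y)): w0; rewrite !mxE enum_rankK_in //.
Qed.

(* The hypothesis says that each x outside S lies in the span of the elements
   of S preceding it, i.e., that S is what the greedy algorithm selects. *)
Lemma greedy_lex_min_basis (R : fieldType) d N (B : 'M[R]_(d, N)) (i : 'I_N)
    (S : {set 'I_N}) :
  \rank B = d -> #|S| = d ->
  (forall x, x \notin S -> exists v : 'cV_N, [/\ B *m v = 0, v x 0 != 0
     & forall y, v y 0 != 0 -> y = x \/ y \in S /\ (cyc_pos i y < cyc_pos i x)%N]) ->
  lex_min_basis (column_matroid B) i S.
Proof.
move=> rankB cardS greedy; split.
  rewrite inE cardS eqxx /= /indep_columns; set C := colsub _ _.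
  (* [C] has [d] columns, so independence of its rows suffices. A covector vanishing on the columns
     in [S] vanishes on every other column by the relation for that column, hence is zero because
     [B] has rank [d]. *)
  suff : row_free C by rewrite /row_free => /eqP ->; rewrite cardS.
  apply: inj_row_free => u uC0.
  have uBS y : y \in S -> (u *m B) 0 y = 0.
    move=> Sy; move/rowP/(_ (enum_rank_in Sy y)): uC0; rewrite !mxE => uC0.
    by rewrite -[RHS]uC0; apply: eq_bigr => k _; rewrite !mxE enum_rankK_in.
  suff uB0 : u *m B = 0.
    by apply/eqP; rewrite -(@mulmx_free_eq0 _ _ _ _ u B) ?uB0 // /row_free rankB.
  apply/rowP => x; rewrite [RHS]mxE; have [/uBS // | nSx] := boolP (x \in S).
  have [v [Bv0 v_x suppv]] := greedy x nSx.
  have /rowP /(_ 0) : u *m B *m v = 0 by rewrite -mulmxA Bv0 mulmx0.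
  rewrite mxE (bigD1 x) //= big1 ?addr0 => [|y neq_yx].
    by move/eqP; rewrite [X in _ == X]mxE mulf_eq0 (negbTE v_x) orbF => /eqP.
  have [-> | v_y] := eqVneq (v y 0) 0; first by rewrite mulr0.
  case: (suppv y v_y) => [eq_yx | [/uBS -> _]]; last by rewrite mul0r.
  by rewrite eq_yx eqxx in neq_yx.
(* At the first difference, [T] has an element [x] preceding the next element of [S]. Then [x] is
   outside [S], while all elements of [S] before [x] are in [T], so the relation for [x] contradicts
   the independence of [T]. *)
move=> T; rewrite inE => /andP [/eqP cardT indepT]; rewrite leNgt; apply/negP => lt_TS.
have := ltxi_first_diff _ lt_TS; rewrite !size_cyc_word cardS cardT.
case=> // k [lt_k eq_take lt_nth].
have Tw : nth 0%N (cyc_word i T) k \in (cyc_word i T : seq nat).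
  by rewrite mem_nth // size_cyc_word cardT.
have [x Tx x_pos] : exists2 x, x \in T & nth 0%N (cyc_word i T) k = cyc_pos i x.
  by move: Tw; rewrite mem_sort => /mapP [x]; rewrite mem_enum; exists x.
have before y : y \in S -> (cyc_pos i y <= cyc_pos i x)%N ->
    cyc_pos i y \in take k (cyc_word i T).
  move=> Sy le_y; rewrite eq_take sorted_mem_take ?sorted_cyc_word //.
  - by rewrite size_cyc_word cardS.
  - by rewrite mem_cyc_word.
  - by rewrite (leq_ltn_trans le_y) -?x_pos.
have nSx : x \notin S.
  apply/negP => /before /(_ (leqnn _)); rewrite -x_pos in_take_leq.
    by rewrite index_uniq ?uniq_cyc_word ?size_cyc_word ?cardT ?ltnn.
  by rewrite size_cyc_word cardT ltnW.
have [v [Bv0 v_x suppv]] := greedy x nSx.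
case/negP: v_x; rewrite (indep_columns_eq0 indepT _ Bv0) ?mxE //.
move=> y /suppv [-> // | [Sy /ltnW lt_y]].
by rewrite -(mem_cyc_word i); apply: mem_take (before y Sy lt_y).
Qed.

(** * The Grassmann necklace *)

Definition hit n (s : nat -> nat) l a : bool :=
  has (fun j => s j == a) (iota l (n - l)).

Lemma hitP n s l a : reflect (exists j, [/\ l <= j, j < n & s j = a]%N) (hit n s l a).
Proof.
apply: (iffP hasP) => [[j] | [j [le_lj lt_jn eq_a]]].
  by rewrite mem_iota => /andP [le_lj lt_j] /eqP; exists j; split=> //; lia.
by exists j; rewrite ?eq_a // mem_iota; lia.
Qed.

Lemma hit_recl n s l a : (l < n)%N -> hit n s l a = (s l == a) || hit n s l.+1 a.
Proof. by move=> lt_ln; rewrite /hit -(subnSK lt_ln). Qed.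

(* At time i only the columns j >= i - n are left, and the rows a >= i come
   first; taking the minimum with i identifies these rows. *)
Definition covered n (s : nat -> nat) i a : bool :=
  has (fun j => minn (s j).+1 i == a.+1) (iota (i - n) (n - (i - n))).

Lemma coveredP n s i a :
  reflect (exists j, [/\ i - n <= j, j < n & minn (s j).+1 i = a.+1]%N) (covered n s i a).
Proof.
apply: (iffP hasP) => [[j] | [j [le_lj lt_jn eq_a]]].
  by rewrite mem_iota => /andP [le_lj lt_j] /eqP; exists j; split=> //; lia.
by exists j; rewrite ?eq_a // mem_iota; lia.
Qed.

Lemma covered_le n s i a : (0 < i <= n)%N -> stair n s ->
  covered n s i a = (a.+1 == i) || (a.+1 < i)%N && hit n s 0 a.
Proof.
move=> i_bnd [s_ge _ _]; apply/coveredP/idP => [[j [_ lt_jn eq_a]] | ].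
  have [-> // | neq_ai /=] := eqVneq a.+1 i.
  by apply/andP; split; [lia | apply/hitP; exists j; split=> //; lia].
case/orP => [/eqP eq_ai | /andP [lt_ai /hitP [j [_ lt_jn eq_a]]]].
  (* Column 0 has [s 0 = n - 1], which truncates to [i]. *)
  by exists 0%N; split; [lia | lia |]; have := s_ge 0%N; lia.
by exists j; split=> //; lia.
Qed.

Lemma covered_ge n s i a : (n <= i)%N -> stair n s -> covered n s i a = hit n s (i - n) a.
Proof.
move=> le_ni [_ s_lt _]; apply/coveredP/hitP => -[j [le_j lt_jn eq_a]]; exists j; split=> //.
  by have := s_lt _ lt_jn; lia.
by have := s_lt _ lt_jn; lia.
Qed.

(** In the graph, path edge [a] joins vertices [a] and [a + 1], and chord [j] joins vertex 0 to
    [s j + 1]. At time [i] the path edges from [i] on come first and merge the vertices from [i] on,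
    so chord [j] reaches [minn (s j).+1 i]. Among the chords [j >= i - n] reaching the same vertex,
    the first is kept. *)
Definition chord n (s : nat -> nat) i j : bool :=
  [&& (0 < i)%N, (i - n <= j)%N
    & (j == i - n)%N || (s j < s j.-1)%N && ((s j).+1 < i)%N].

(** The path edges below [i] come after the chords [j >= i - n] and are added upwards from vertex 0,
    so edge [a] is rejected exactly when a chord has already reached [a + 1]. *)
Definition in_necklace n s i y : bool :=
  if (y < n)%N then ~~ covered n s i y else chord n s i (y - n).

Definition necklace n s i : {set 'I_(n + n)} := [set y | in_necklace n s i (val y)].

(* step x i says that the decorated permutation maps x to i. *)
Inductive step n (s : nat -> nat) : nat -> nat -> Prop :=
| step_first : (0 < n)%N -> step n s n 0
| step_descent j : (0 < j < n)%N -> (s j < s j.-1)%N -> step n s (n + j) (s j).+1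
| step_level j : (0 < j < n)%N -> s j = s j.-1 -> step n s (n + j) (n + j).-1
| step_free a : (a < n)%N -> (forall j, (j < n)%N -> s j <> a) -> step n s a a.+1
| step_last j : (j < n)%N -> (j.+1 < n -> s j.+1 < s j)%N -> step n s (s j) (n + j).

Lemma step_neq n s x i : stair n s -> step n s x i -> x <> i.
Proof.
case=> _ s_lt _; case.
- lia.
- by move=> j j_bnd; have := s_lt j; lia.
- by move=> j; lia.
- by move=> a; lia.
- by move=> j lt_jn _; have := s_lt j lt_jn; lia.
Qed.

(** This excludes non-square shapes, in which some label below [n] is sent to one that is not
    larger. *)
Lemma step_exceedance n s x i : stair n s -> step n s x i -> (x < n)%N -> (x < i)%N.
Proof. by case=> _ s_lt _; case=> [|j|j|a|j lt_jn _]; try lia; have := s_lt j lt_jn; lia. Qed.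

(** The sources of the five cases are disjoint: label [n], later columns at a descent or at a level,
    and rows missed or attained by [s]. An attained row determines the last [j] with that value, by
    monotonicity. *)
Lemma step_fun n s x i i' : stair n s -> step n s x i -> step n s x i' -> i = i'.
Proof.
move=> [s_ge s_lt s_mono] st; move: {-2}x (erefl x) => x' eq_x' st'; move: eq_x'.
case: st => [n_gt0|j j_bnd desc|j j_bnd lev|a a_lt na|j j_lt last_j] eq_x.
- case: st' eq_x => [|k k_bnd _|k k_bnd _|a a_lt _|k lt_kn _] eq_x; try lia.
  by have := s_lt _ lt_kn; lia.
- case: st' eq_x => [|k k_bnd _|k k_bnd lev|a a_lt _|k lt_kn _] eq_x; try lia.
  + by have -> : j = k by lia.
  + by have eq_jk : j = k by [lia]; move: desc; rewrite eq_jk lev ltnn.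
  + by have := s_lt _ lt_kn; lia.
- case: st' eq_x => [|k k_bnd desc|k k_bnd _|a a_lt _|k lt_kn _] eq_x; try lia.
  + by have eq_jk : j = k by [lia]; move: desc; rewrite -eq_jk lev ltnn.
  + by have := s_lt _ lt_kn; lia.
- case: st' eq_x => [|k k_bnd _|k k_bnd _|b _ _|k lt_kn _] eq_x; try lia.
  by case: (na k).
- have lt_sj := s_lt _ j_lt.
  case: st' eq_x => [|k k_bnd _|k k_bnd _|b b_lt nb|k k_lt last_k] eq_x; try lia.
    by case: (nb j).
  have := s_mono j.+1 k; have := s_mono k.+1 j; lia.
Qed.

(** For [i < n], losing path edge [i] splits vertex [i] from the merged ones. It is then reached by
    the first chord with [s j = i - 1], or else by path edge [i - 1]; at [i = 0] chord 0 reconnects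
    the two parts. For [i >= n], chord [l = i - n] is lost, and its end is reached by chord [l + 1]
    at a level and by path edge [s l] otherwise. *)
Lemma exchange n s i : stair n s -> (i < n + n)%N -> exists x,
  [/\ (x < n + n)%N, step n s x i, in_necklace n s i i, ~~ in_necklace n s i x
    & forall y, (y < n + n)%N ->
        in_necklace n s i.+1 y = (y == x) || (y != i) && in_necklace n s i y].
Proof.
move=> st lt_i; case: (st) => s_ge s_lt s_mono.
have [lt_in | le_ni] := ltnP i n.
  have [i0 | i_gt0] := posnP i.
    have cov0 a : covered n s 0 a = false.
      by apply/coveredP => -[j [_ _]]; rewrite minn0.
    have cov1 a : covered n s 1 a = (a == 0%N) by rewrite covered_le //; lia.
    subst i; exists n; rewrite /in_necklace lt_in ltnn !cov0 /chord; split=> //.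
    - lia.
    - exact: step_first.
    move=> y lt_y; case: ltnP => [lt_yn | le_ny].
      by rewrite cov0 cov1; have := ltn_eqF lt_yn; lia.
    by have := s_lt (y - n)%N; lia.
  have covi a : covered n s i a = (a.+1 == i) || (a.+1 < i)%N && hit n s 0 a.
    by apply: covered_le => //; lia.
  have covSi a : covered n s i.+1 a = (a == i) || (a < i)%N && hit n s 0 a.
    by apply: covered_le => //; lia.
  have in_i : in_necklace n s i i by rewrite /in_necklace lt_in covi; lia.
  have [/hitP hit_i | nhit] := boolP (hit n s 0 i.-1).
    have [j /andP [lt_jn /eqP s_j] j_min] : {j | (j < n)%N && (s j == i.-1)
        & forall k, (k < n)%N && (s k == i.-1) -> (j <= k)%N}.
      have ex : exists j, (j < n)%N && (s j == i.-1).
        by case: hit_i => j [_ lt_jn s_j]; exists j; rewrite lt_jn s_j eqxx.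
      by case: (ex_minnP ex) => j; exists j.
    have j_gt0 : (0 < j)%N.
      by rewrite lt0n; apply/eqP => j0; have := s_ge _ lt_jn; rewrite s_j j0; lia.
    have desc : (s j < s j.-1)%N.
      have := s_mono j.-1 j; have := j_min j.-1; lia.
    exists (n + j)%N; split=> //; first lia.
    - have -> : i = (s j).+1 by lia.
      by apply: step_descent; lia.
    - by rewrite /in_necklace ltnNge leq_addr /= addKn /chord; lia.
    move=> y lt_y; rewrite /in_necklace; case: ltnP => [lt_yn | le_ny].
      rewrite covi covSi; have [y_i | y_i] := eqVneq y.+1 i; last first.
        by case: (hit n s 0 y); lia.
      have -> : hit n s 0 y by apply/hitP; exists j; split=> //; lia.
      by lia.
    have {le_ny} [k y_k] : exists k, y = (n + k)%N by exists (y - n)%N; lia.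
    rewrite /chord y_k addKn eqn_add2l; have [-> | neq_kj] := eqVneq k j; first lia.
    by have := j_min k; have := s_mono j k.-1; lia.
  exists i.-1; split=> //; first lia.
  - rewrite -[X in step _ _ _ X](prednK i_gt0); apply: step_free; first lia.
    by move=> j lt_jn s_j; case/hitP: nhit; exists j.
  - by rewrite /in_necklace covi prednK // eqxx (ltnW lt_in).
  move=> y lt_y; rewrite /in_necklace; case: ltnP => [lt_yn | le_ny].
    rewrite covi covSi; have [y_i | y_i] := eqVneq y.+1 i; last first.
      by case: (hit n s 0 y); lia.
    have -> : hit n s 0 y = false by apply/negbTE; rewrite -y_i in nhit.
    by lia.
  have s_y : (s (y - n) <> i.-1)%N.
    by move=> s_y; case/hitP: nhit; exists (y - n)%N; split=> //; lia.
  by rewrite /chord; lia.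
pose l := (i - n)%N; have lt_ln : (l < n)%N by lia.
have i_l : i = (n + l)%N by lia.
have lt_sl := s_lt _ lt_ln.
have covi a : covered n s i a = (s l == a) || hit n s l.+1 a.
  by rewrite covered_ge // hit_recl.
have covSi a : covered n s i.+1 a = hit n s l.+1 a.
  by rewrite covered_ge // ?subSn //; lia.
have in_i : in_necklace n s i i by rewrite /in_necklace ltnNge le_ni /= /chord; lia.
have [/andP [lt_Sl /eqP level] | nlevel] := boolP ((l.+1 < n)%N && (s l.+1 == s l)).
  exists i.+1; split=> //; first lia.
  - rewrite [X in step _ _ X _](_ : _ = n + l.+1)%N; last lia.
    have -> : i = (n + l.+1).-1 by lia.
    by apply: step_level => //; lia.
  - rewrite /in_necklace; case: ltnP => [|_]; first lia.
    by rewrite /chord subSn //= -/l level ltnn; lia.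
  move=> y lt_y; rewrite /in_necklace; case: ltnP => [lt_yn | le_ny].
    rewrite covi covSi; have [<- | _] := eqVneq (s l) y; last by lia.
    have -> : hit n s l.+1 (s l) by apply/hitP; exists l.+1.
    by lia.
  have {le_ny} [k y_k] : exists k, y = (n + k)%N by exists (y - n)%N; lia.
  rewrite /chord y_k addKn subSn // -/l; have := s_lt k; have := s_lt k.-1; lia.
have nhit : hit n s l.+1 (s l) = false.
  apply/hitP => -[j [lt_lj lt_jn s_j]].
  by have := s_mono l.+1 j lt_lj lt_jn; have := s_mono l l.+1; lia.
exists (s l); split=> //; first lia.
- rewrite i_l; apply: step_last => // lt_Sl.
  by have := s_mono l l.+1; lia.
- by rewrite /in_necklace lt_sl covi eqxx.
move=> y lt_y; rewrite /in_necklace; case: ltnP => [lt_yn | le_ny].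
  rewrite covi covSi; have [<- | _] := eqVneq (s l) y; first by rewrite nhit ?eqxx.
  by lia.
have {le_ny} [k y_k] : exists k, y = (n + k)%N by exists (y - n)%N; lia.
rewrite /chord y_k addKn subSn // -/l; have := s_lt k; have := s_lt k.-1.
have [eq_kl | ] := eqVneq k l.+1; last by lia.
by rewrite eq_kl /=; have := s_mono l l.+1; lia.
Qed.

Lemma card_necklace n s i : stair n s -> (i <= n + n)%N -> #|necklace n s i| = n.
Proof.
move=> st; elim: i => [|i IHi] lt_i.
  rewrite -[RHS](card_ord_lt (leq_addr n n)); congr #|pred_of_set _|.
  apply/setP => y; rewrite !inE /in_necklace /chord /=; case: ifP => // _.
  by apply/negP => /coveredP [j [_ _]]; rewrite minn0.
have [x [lt_x _ in_i nin_x eq_in]] := exchange st lt_i.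
pose X := Ordinal lt_x; pose I := Ordinal lt_i.
have -> : necklace n s i.+1 = X |: (necklace n s i :\ I).
  by apply/setP => y; rewrite !inE -!val_eqE /= eq_in.
rewrite cardsU1 !inE /= (negbTE nin_x) andbF /=.
by have := cardsD1 I (necklace n s i); rewrite inE in_i IHi ?(ltnW lt_i).
Qed.

Lemma necklace_exchange n s (i : 'I_(n + n)) : stair n s -> exists x : 'I_(n + n),
  [/\ step n s x i, x \notin necklace n s i, i \in necklace n s i
    & necklace n s (ordS i) = x |: (necklace n s i :\ i)].
Proof.
move=> st; have [x [lt_x st_x in_i nin_x eq_in]] := exchange st (ltn_ord i).
exists (Ordinal lt_x); rewrite !inE; split=> //; apply/setP => y.
rewrite !inE -!val_eqE /= -eq_in //.
(* After the last label the necklace closes up: at time [n + n] no chord is left, so all path edges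
   are taken, as at time 0. *)
have [lt_Si|ge_Si] := ltnP i.+1 (n + n)%N; first by rewrite modn_small.
have -> : i.+1 = (n + n)%N by apply/eqP; rewrite eqn_leq ge_Si ltn_ord.
rewrite modnn.
rewrite /in_necklace; case: ltnP => [_|le_ny].
  have -> : covered n s 0 y = false by apply/coveredP => -[j [_ _]]; rewrite minn0.
  have -> // : covered n s (n + n) y = false.
  by apply/coveredP => -[j [le_nj lt_jn _]]; move: le_nj lt_jn; lia.
by rewrite /chord addKn /= [RHS]andbC; have := ltn_ord y; lia.
Qed.

(** * Cycles of the graph as linear relations between columns *)

Section Dependency.
Variables (R : realFieldType) (n : nat) (s : nat -> nat).

Definition top (o : option nat) := if o is Some k then (s k).+1 else 0%N.

(** The cycle formed by chord [j], chord [o] and the path between their ends; [None] stands for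
    vertex 0, where every chord starts. The signs undo those of the staircase columns. *)
Definition dependency (j : nat) (o : option nat) : 'cV[R]_(n + n) :=
  \col_y if (y < n)%N
         then (-1) ^+ (n - y.+1)%N * ((y < top o)%N%:R - (y < (s j).+1)%N%:R)
         else (y == n + j :> nat)%N%:R - (o == Some (y - n)%N)%:R.

Lemma dependencyP j o : (j < n)%N -> (forall k, o = Some k -> (k < n)%N) ->
  stair_matrix R n s *m dependency j o = 0.
Proof.
move=> lt_jn o_lt; apply/colP => a; rewrite !mxE big_split_ord /=.
rewrite (bigD1 a) //= [X in _ + X + _]big1 => [|b neq_ba]; last first.
  rewrite !mxE /= ltn_ord (_ : (a == b :> nat) = false) ?mul0r //.
  by apply/negbTE; rewrite eq_sym; exact: neq_ba.
rewrite !mxE /= ltn_ord eqxx mul1r addr0.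
rewrite (eq_bigr (fun k : 'I_n => (-1) ^+ (n - a.+1)%N * ((a <= s k)%N%:R *
    ((k == j :> nat)%N%:R - (o == Some (val k))%:R)))); last first.
  by move=> k _; rewrite !mxE /= !ltnNge !leq_addr /= addKn eqn_add2l mulrA.
rewrite -mulr_sumr -mulrDr; apply/eqP; rewrite mulf_eq0; apply/orP; right.
rewrite (eq_bigr (fun k : 'I_n => (a <= s k)%N%:R * (k == j :> nat)%N%:R -
    (a <= s k)%N%:R * (o == Some (val k))%:R)); last by move=> k _; rewrite mulrBr.
rewrite sumrB (bigD1 (Ordinal lt_jn)) //= eqxx mulr1 big1 ?addr0 => [|k]; last first.
  by rewrite -val_eqE /= => /negbTE ->; rewrite mulr0.
rewrite ltnS addrA subrK subr_eq0.
case: o o_lt => [k /(_ k erefl) lt_kn|_] /=; last first.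
  by rewrite big1 // => k _; rewrite mulr0.
rewrite (bigD1 (Ordinal lt_kn)) //= eqxx mulr1 big1 ?addr0 ?ltnS //.
move=> l; rewrite -val_eqE /= => neq_lk.
by rewrite (_ : (Some k == Some (val l)) = false) ?mulr0 //; apply/eqP => -[]; apply/eqP; rewrite eq_sym.
Qed.

End Dependency.

Lemma dependency_supp (R : realFieldType) n s j o (y : 'I_(n + n)) :
  dependency R n s j o y 0 != 0 ->
  if (y < n)%N then (y < top s o)%N != (y < (s j).+1)%N
  else (y == n + j :> nat)%N || (o == Some (y - n)%N).
Proof.
rewrite mxE; case: ifP => _.
  by apply: contraNneq => ->; rewrite subrr mulr0.
case: (val y =P (n + j)%N) => //= _; case: (o =P Some (y - n)%N) => //= _.
by rewrite subrr eqxx.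
Qed.

Lemma covered_lt n s i a : covered n s i a -> (a < i)%N.
Proof. by case/coveredP => j [_ _]; lia. Qed.

(** Walk down the path from vertex [t] until a chord is met. As [s] is decreasing, this is the first
    available [j] whose truncated end is at most [t]; without one, the walk ends at vertex 0,
    encoded by [None]. *)
Lemma next_chord n s i t : stair n s -> (t <= i)%N -> exists o : option nat,
  [/\ forall k, o = Some k ->
        [/\ (k < n)%N, (i - n <= k)%N, chord n s i k & (minn (s k).+1 i <= t)%N],
      forall a, (top s o <= a < t)%N -> ~~ covered n s i a
    & forall j, (0 < i)%N -> (i - n <= j < n)%N -> (minn (s j).+1 i <= t)%N ->
        exists2 k, o = Some k & (k <= j)%N].
Proof.
move=> st le_ti; have [s_ge s_lt s_mono] := st.
have [i0 | i_gt0] := posnP i; rewrite ?i0.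
  by exists None; split=> // a _; apply/negP => /covered_lt.
pose P j := (i - n <= j < n)%N && (minn (s j).+1 i <= t)%N.
have [/hasP [j _ Pj] | /hasPn noP] := boolP (has P (iota 0 n)); last first.
  have nP j : ~~ P j.
    apply/negP => Pj; have /noP /negP : j \in iota 0 n; last by apply.
    by move: Pj; rewrite mem_iota /P; lia.
  exists None; split=> // [a /andP [_ lt_at] | j _ j_bnd le_t]; last first.
    by case/negP: (nP j); rewrite /P j_bnd.
  apply/negP => /coveredP [j [le_j lt_j eq_a]]; case/negP: (nP j).
  by rewrite /P le_j lt_j eq_a.
have exP : exists j, P j by exists j.
case: (ex_minnP exP) => k /andP [/andP [le_k lt_k] le_t] k_min.
exists (Some k); split=> [_ [<-] | a | l _ l_bnd le_l]; last first.
- by exists k => //; apply: k_min; rewrite /P l_bnd.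
- move=> /= /andP [le_ka lt_at]; apply/negP => /coveredP [l [le_l lt_l eq_a]].
  have := k_min l; rewrite /P; have := s_mono k l; lia.
split=> //; rewrite /chord i_gt0 le_k /=; have [// | neq_k /=] := eqVneq k (i - n)%N.
have := k_min k.-1; rewrite /P; lia.
Qed.

Lemma necklace_lex_min (R : realFieldType) n s (i : 'I_(n + n)) : stair n s ->
  lex_min_basis (column_matroid (stair_matrix R n s)) i (necklace n s i).
Proof.
move=> st; have [s_ge s_lt s_mono] := st; have lt_i := ltn_ord i.
apply: greedy_lex_min_basis; first exact: stair_matrix_rank.
  by apply: card_necklace => //; apply: ltnW.
move=> x; have lt_x := ltn_ord x; rewrite inE /in_necklace /=; case: ltnP => [lt_xn | le_nx].
  rewrite negbK => cov_x; have lt_xi := covered_lt cov_x.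
  case/coveredP: (cov_x) => j [le_j lt_j eq_x].
  (* A rejected path edge [x] lies on the cycle of [k1], the first chord whose truncated end is
     [x + 1], and the chord [o] met when walking down from [x]. Path edges of this cycle above [x]
     can only be those from [i] on, which come first. *)
  have [o1 [o1_chord _ o1_min]] := next_chord st lt_xi.
  have [k1 eq_o1 le_k1j] : exists2 k, o1 = Some k & (k <= j)%N.
    by apply: o1_min; rewrite ?eq_x ?le_j //; lia.
  have [lt_k1 le_k1 chord_k1 min_k1] := o1_chord _ eq_o1.
  have eq_k1 : minn (s k1).+1 i = x.+1 by have := s_mono _ _ le_k1j lt_j; lia.
  have [o [o_chord o_unc o_min]] := next_chord st (ltnW lt_xi).
  have le_top : (top s o <= x)%N.
    by case: o o_chord {o_unc o_min} => //= k /(_ k erefl) [_ _ _]; lia.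
  exists (dependency R n s k1 o); split.
  - by apply: dependencyP => // k /o_chord [].
  - have lt_xk1 : (x < (s k1).+1)%N by lia.
    by rewrite mxE lt_xn lt_xk1 ltnNge le_top /= sub0r mulrN mulr1 oppr_eq0 signr_eq0.
  move=> y /dependency_supp; rewrite inE /in_necklace /= !cyc_posE; have lt_y := ltn_ord y.
  rewrite [(i <= x)%N]leqNgt lt_xi /=.
  case: ltnP => [lt_yn | le_ny].
    have [-> _ | neq_yx] := eqVneq y x; first by left.
    move=> supp_y; right; have [lt_yi | le_iy] := ltnP y i.
      have lt_yx : (y < x)%N.
        by move: neq_yx; rewrite -val_eqE /= => neq_yx; move: supp_y; lia.
      split; last by lia.
      by apply: o_unc; move: supp_y; lia.
    split; last by lia.
    by apply/negP => /covered_lt; lia.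
  case/orP=> [/eqP eq_y | /eqP /o_chord [_ le_y chord_y _]]; right.
    rewrite eq_y addKn; split=> //.
    by have -> : (i <= n + k1)%N; lia.
  split=> //; have -> : (i <= y)%N; lia.
have [k x_k] : exists k, x = (n + k)%N :> nat by exists (x - n)%N; lia.
rewrite x_k addKn => nchord_x.
(* For a rejected chord [k], walk down from its truncated end. If [k >= i - n], this finds an
   earlier kept chord with the same truncated end, and the path between the two uses only edges from
   [i] on. If [k < i - n], the chord comes after all path edges and all kept chords. *)
have le_ti : (minn (s k).+1 i <= i)%N by lia.
have lt_k : (k < n)%N by lia.
have [o [o_chord o_unc o_min]] := next_chord st le_ti.
exists (dependency R n s k o); split.
- by apply: dependencyP => // l /o_chord [].
- rewrite mxE ltnNge le_nx /= x_k eqxx addKn.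
  have [/o_chord [_ _]|_] := eqVneq o (Some k); last by rewrite subr0 oner_eq0.
  by rewrite (negbTE nchord_x).
move=> y /dependency_supp; rewrite inE /in_necklace /= !cyc_posE; have lt_y := ltn_ord y.
case: ltnP => [lt_yn supp_y | le_ny].
  right; have [le_iy | lt_yi] := leqP i y.
    split; last by case: (leqP i x); lia.
    by apply/negP => /covered_lt; lia.
  have lt_kl : (k < i - n)%N.
    rewrite ltnNge; apply/negP => le_k.
    have [||l eq_o le_lk] := o_min k _ _ (leqnn _); [lia | lia |].
    have [_ _ _] := o_chord _ eq_o; move: supp_y; rewrite eq_o /=.
    by have := s_mono _ _ le_lk lt_k; lia.
  split; last by have -> : (i <= x)%N = false; lia.
  apply: o_unc; move: supp_y; have := s_lt k lt_k.
  case: o o_chord {o_min} => [l /(_ l erefl) [lt_l _ _]|_] /=; lia.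
case/orP=> [/eqP eq_y | /eqP eq_o]; first by left; apply: val_inj => /=; lia.
have [lt_l le_l chord_l min_l] := o_chord _ eq_o; right; split=> //.
have [l y_l] : exists l, y = (n + l)%N :> nat by exists (y - n)%N; lia.
rewrite y_l addKn in eq_o lt_l le_l chord_l min_l *.
have [le_k | lt_ki] := leqP (i - n)%N k; last first.
  by have -> : (i <= n + l)%N; [lia | have -> : (i <= x)%N = false; lia].
have neq_lk : l <> k by move=> eq_lk; rewrite -eq_lk chord_l in nchord_x.
have i_gt0 : (0 < i)%N by case/and3P: chord_l.
have [|l' eq_o' le_lk] := o_min k i_gt0 _ (leqnn _); first lia.
have eq_ll : l = l' by move: eq_o'; rewrite eq_o => -[].
by have -> : (i <= n + l)%N; [lia | have -> : (i <= x)%N; lia].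
Qed.

(** * The decorated permutation of the matroid *)

(** The map [nu], sending [i] to the element that enters when [i] leaves, is the inverse of the
    decorated permutation. It is injective because [step] is functional. *)
Lemma step_choice n s : stair n s -> exists nu : {perm 'I_(n + n)},
  forall i, [/\ step n s (nu i) i, nu i \notin necklace n s i, i \in necklace n s i
    & necklace n s (ordS i) = nu i |: (necklace n s i :\ i)].
Proof.
move=> st; have /fin_all_exists [nu nuP] := fun i => necklace_exchange i st.
have nu_inj : injective nu.
  move=> i i' eq_nu; have [st_i _ _ _] := nuP i; have [st_i' _ _ _] := nuP i'.
  by apply: val_inj; apply: (step_fun st st_i); rewrite eq_nu.
by exists (perm nu_inj) => i; rewrite permE.
Qed.

Lemma stair_perm n s : stair n s -> exists q : {perm 'I_(n + n)},
  forall x i : 'I_(n + n), step n s x i -> q x = i.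
Proof.
move=> st; have [nu nuP] := step_choice st; exists (nu^-1)%g => x i st_x.
have [st_x' _ _ _] := nuP ((nu^-1)%g x); rewrite permKV in st_x'.
exact/val_inj/(step_fun st st_x').
Qed.

(** Lexicographically minimal bases are unique, so any admissible family equals [necklace].
    Consecutive members always differ, so only the exchange clause applies, and the entering element
    can be recovered from them. *)
Lemma matroid_dperm_stair (R : realFieldType) n s (p : decorated_perm (n + n)) :
  stair n s ->
  matroid_dperm (column_matroid (stair_matrix R n s)) p <->
  forall x i : 'I_(n + n), step n s x i -> p x = i.
Proof.
move=> st; have [nu nuP] := step_choice st.
have neq_nu i : nu i != i.
  by have [_ nin_nu in_i _] := nuP i; apply: contraNneq nin_nu => ->.
have neq_S (i : 'I_(n + n)) : necklace n s (ordS i) <> necklace n s i.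
  have [_ nin_nu _ eq_S] := nuP i; move=> eqS; move: nin_nu.
  by rewrite -eqS eq_S setU11.
split=> [[I I_lex pP] x i st_x | pP].
  have eq_I j : I j = necklace n s j.
    exact: lex_min_basis_uniq (I_lex j) (necklace_lex_min _ _ st).
  have p_nu j : p (nu j) = j.
    have [_] := pP j; rewrite !eq_I => /(_ (neq_S j)); apply=> //.
    by have [] := nuP j.
  have [st_x' _ _ _] := nuP ((nu^-1)%g x); rewrite permKV in st_x'.
  have -> : i = (nu^-1)%g x by apply/val_inj/(step_fun st st_x).
  by rewrite -{1}[x](permKV nu) p_nu.
exists (fun i : 'I_(n + n) => necklace n s i) => [i | i]; first exact: necklace_lex_min.
split=> [/neq_S // | _ j neq_j eq_S].
have [st_i nin_nu in_i eq_Snu] := nuP i; rewrite eq_Snu in eq_S.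
suff -> : j = nu i by apply: pP.
have : nu i \in j |: (necklace n s i :\ i) by rewrite -eq_S setU11.
by rewrite !inE => /predU1P [-> // | /andP [_]]; move: nin_nu; rewrite inE => /negbTE ->.
Qed.

Lemma step_total n s x : stair n s -> (x < n + n)%N ->
  exists2 i, (i < n + n)%N & step n s x i.
Proof.
move=> st lt_x; have [nu nuP] := step_choice st.
have [st_x _ _ _] := nuP ((nu^-1)%g (Ordinal lt_x)); rewrite permKV in st_x.
by exists ((nu^-1)%g (Ordinal lt_x)).
Qed.

(** * Pipes on the square *)

Section Pipes.
Variables (n : nat) (rows : seq (seq bool)).
Hypothesis box : forall r c, is_box rows r c = (r < n)%N && (c < n)%N.

Definition edge_row e := match e with Vert r _ | Horiz r _ => r end.
Definition edge_col e := match e with Vert _ c | Horiz _ c => c end.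

Lemma pipe_in e f : edge_in rows e -> pipe rows e f -> pipe rows (edge_next rows e) f.
Proof. by move=> in_e p_ef; case: p_ef in_e => // {}e /negbTE ->. Qed.

Lemma pipe_out e f : ~~ edge_in rows e -> pipe rows e f -> f = e.
Proof. by move=> out_e p_ef; case: p_ef out_e => // {}e {}f ->. Qed.

Lemma pipe_det e f f' : pipe rows e f -> pipe rows e f' -> f = f'.
Proof.
move=> p_ef; elim: p_ef f' => [{}e out_e f' /(pipe_out out_e) // | {}e {}f in_e _ IH f'].
by move/(pipe_in in_e)/IH.
Qed.

Lemma pipe_mono e f : pipe rows e f ->
  (edge_row e <= edge_row f)%N /\ (edge_col e <= edge_col f)%N.
Proof.
elim=> {e f} [e // | [r c|r c] f _ _ [] /=]; case: ifP => _ /=; lia.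
Qed.

Lemma pipe_total e : exists f, pipe rows e f.
Proof.
have [m] := ubnP (n + n - (edge_row e + edge_col e)).
elim: m e => // m IHm e lt_m.
have [in_e | out_e] := boolP (edge_in rows e); last by exists e; apply: pipe_exit.
have [|f p_ef] := IHm (edge_next rows e); last by exists f; apply: pipe_box.
move: in_e lt_m; case: e => r c /=; rewrite box; case: ifP => _ /=; lia.
Qed.

Definition exit_label e :=
  match e with Vert r _ => r | Horiz _ c => (n - c.+1 + n)%N end.

(** An equivalence, because pipes are both followed from their entry to an inner edge and built
    backwards from their exit. *)
Lemma pipe_east r c c' f : (r < n)%N -> (c <= c')%N -> (c' <= n)%N ->
  (forall c'', c <= c'' < c' -> ~~ is_plus rows r c'')%N ->
  pipe rows (Vert r c) f <-> pipe rows (Vert r c') f.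
Proof.
move=> lt_rn /subnKC <-; move: (c' - c)%N => k; elim: k c => [|k IHk] c le_c nplus.
  by rewrite addn0.
have out_c : ~~ is_plus rows r c by apply: nplus; lia.
have in_c : edge_in rows (Vert r c) by rewrite /= box; lia.
have nextE : edge_next rows (Vert r c) = Vert r c.+1 by rewrite /= (negbTE out_c).
rewrite -addSnnS -IHk; [|lia|by move=> c'' c_bnd; apply: nplus; lia].
rewrite -nextE; split; [exact: pipe_in | exact: pipe_box].
Qed.

Lemma pipe_south r r' c f : (c < n)%N -> (r <= r')%N -> (r' <= n)%N ->
  (forall r'', r <= r'' < r' -> ~~ is_plus rows r'' c)%N ->
  pipe rows (Horiz r c) f <-> pipe rows (Horiz r' c) f.
Proof.
move=> lt_cn /subnKC <-; move: (r' - r)%N => k; elim: k r => [|k IHk] r le_r nplus.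
  by rewrite addn0.
have out_r : ~~ is_plus rows r c by apply: nplus; lia.
have in_r : edge_in rows (Horiz r c) by rewrite /= box; lia.
have nextE : edge_next rows (Horiz r c) = Horiz r.+1 c by rewrite /= (negbTE out_r).
rewrite -addSnnS -IHk; [|lia|by move=> r'' r_bnd; apply: nplus; lia].
rewrite -nextE; split; [exact: pipe_in | exact: pipe_box].
Qed.

Lemma pipe_elbow_south r c f : (r < n)%N -> (c < n)%N -> is_plus rows r c ->
  pipe rows (Vert r c) f <-> pipe rows (Horiz r.+1 c) f.
Proof.
move=> lt_rn lt_cn plus_rc; have in_rc : edge_in rows (Vert r c) by rewrite /= box lt_rn.
have nextE : edge_next rows (Vert r c) = Horiz r.+1 c by rewrite /= plus_rc.
by rewrite -nextE; split; [exact: pipe_in | exact: pipe_box].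
Qed.

Lemma pipe_elbow_east r c f : (r < n)%N -> (c < n)%N -> is_plus rows r c ->
  pipe rows (Horiz r c) f <-> pipe rows (Vert r c.+1) f.
Proof.
move=> lt_rn lt_cn plus_rc; have in_rc : edge_in rows (Horiz r c) by rewrite /= box lt_rn.
have nextE : edge_next rows (Horiz r c) = Vert r c.+1 by rewrite /= plus_rc.
by rewrite -nextE; split; [exact: pipe_in | exact: pipe_box].
Qed.

Lemma exit_vert r : pipe rows (Vert r n) (Vert r n).
Proof. by apply: pipe_exit; rewrite /= box ltnn andbF. Qed.

Lemma exit_horiz c : pipe rows (Horiz n c) (Horiz n c).
Proof. by apply: pipe_exit; rewrite /= box ltnn. Qed.

Section FullLastColumn.
Hypothesis last_plus : forall r, (r < n)%N -> is_plus rows r n.-1.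

Lemma exit_row e f r : pipe rows e f -> (r <= edge_row e)%N -> (r <= n)%N ->
  (r <= exit_label f)%N.
Proof. by move/pipe_mono => []; case: f => r' c' /=; lia. Qed.

(** The full last column bends every pipe travelling east in row [r] southwards, at the latest
    there, so none leaves through row [r]. *)
Lemma exit_below_vert e f r c : pipe rows e f -> e = Vert r c ->
  (r < n)%N -> (c < n)%N -> (r < exit_label f)%N.
Proof.
move=> p_ef; elim: p_ef r c => {e f} [e out_e | e f _ p_nf IH] r c eq_e lt_r lt_c.
  by move: out_e; rewrite eq_e /= box lt_r lt_c.
move: p_nf IH; rewrite eq_e /=; case: ifP => [_ p_nf _ | nplus _ IH].
  by apply: (exit_row p_nf).
apply: (IH r c.+1) => //.
have [eq_c | ] := eqVneq c n.-1; last lia.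
by rewrite eq_c last_plus in nplus.
Qed.

Lemma exit_below_horiz e f r c : pipe rows e f -> e = Horiz r c ->
  (r <= n)%N -> (c < n.-1)%N -> (r < exit_label f)%N.
Proof.
move=> p_ef; elim: p_ef r c => {e f} [e out_e | e f in_e p_nf IH] r c eq_e le_r lt_c.
  by move: out_e; rewrite eq_e /= box; lia.
move: in_e p_nf IH; rewrite eq_e /= box => /andP [lt_r _].
case: ifP => [_ p_nf _ | _ _ IH]; last by apply/ltnW/(IH r.+1 c).
by apply: (exit_below_vert p_nf) => //; lia.
Qed.

(** A plus before the last column would send the pipe south into row [r + 1] or the bottom border,
    and by [exit_below_horiz] it would leave with a label above [r + 1]. *)
Lemma no_plus_of_exit e f r c : pipe rows e f -> e = Vert r c -> (r < n)%N ->
  exit_label f = r.+1 -> forall c', (c <= c' < n.-1)%N -> ~~ is_plus rows r c'.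
Proof.
move=> p_ef; elim: p_ef r c => {e f} [e out_e | e f in_e p_nf IH] r c eq_e lt_r f_r c' c'_bnd.
  by move: out_e; rewrite eq_e /= box; lia.
move: in_e p_nf IH; rewrite eq_e /= box => /andP [_ lt_c].
case: ifP => [plus_rc p_nf _ | nplus_rc _ IH].
  by have := exit_below_horiz p_nf erefl lt_r; rewrite f_r ltnn; lia.
have [-> | neq_c] := eqVneq c' c; first by rewrite nplus_rc.
by apply: (IH r c.+1) => //; lia.
Qed.

End FullLastColumn.
Lemma exit_south_no_plus e f r c : pipe rows e f -> f = Horiz n c -> e = Horiz r c ->
  forall r', (r <= r' < n)%N -> ~~ is_plus rows r' c.
Proof.
move=> p_ef; elim: p_ef r c => {e f} [e out_e | e f in_e p_nf IH] r c eq_f eq_e r' r'_bnd.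
  by move: eq_f; rewrite eq_e => -[eq_r]; lia.
move: in_e p_nf IH; rewrite eq_e /= box => /andP [lt_r lt_c].
case: ifP => [_ p_nf _ | nplus_rc _ IH].
  by have [_] := pipe_mono p_nf; rewrite eq_f /= ltnn.
have [-> | neq_r] := eqVneq r' r; first by rewrite nplus_rc.
by apply: (IH r.+1 c) => //; lia.
Qed.

(** Pipes never move west, so one that enters column [c] from the west and leaves at its foot bends
    at once and then goes straight down. *)
Lemma exit_south_plus r c : (r < n)%N -> (c < n)%N ->
  pipe rows (Vert r c) (Horiz n c) ->
  is_plus rows r c /\ forall r', (r < r' < n)%N -> ~~ is_plus rows r' c.
Proof.
move=> lt_r lt_c p_rc; have in_rc : edge_in rows (Vert r c) by rewrite /= box lt_r.
have /= := pipe_in in_rc p_rc; case: ifP => [_ p_n | _ /pipe_mono [_]]; last first.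
  by rewrite /= ltnn.
by split=> // r'; apply: (exit_south_no_plus p_n).
Qed.

Lemma exit_form e f : pipe rows e f ->
  match e with
  | Vert r c => (r < n)%N && (c <= n)%N
  | Horiz r c => (r <= n)%N && (c < n)%N
  end ->
  (exists2 r, (r < n)%N & f = Vert r n) \/ (exists2 c, (c < n)%N & f = Horiz n c).
Proof.
elim=> {e f} [[r c|r c] /= | [r c|r c] f /= in_e _ IH bnd_e].
- rewrite box => out_rc rc_bnd; left; exists r; first lia.
  by congr Vert; lia.
- rewrite box => out_rc rc_bnd; right; exists c; first lia.
  by congr Horiz; lia.
- by apply: IH; move: in_e; rewrite box; case: ifP => _; lia.
- by apply: IH; move: in_e; rewrite box; case: ifP => _; lia.
Qed.

End Pipes.

(** * From the permutation to the filling, and back *)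

Lemma shape_square_box n (rows : seq (seq bool)) : shape rows = nseq n n ->
  forall r c, is_box rows r c = (r < n)%N && (c < n)%N.
Proof.
move=> sq r c; have sz_rows : size rows = n by rewrite -(size_map size) -/(shape _) sq size_nseq.
rewrite /is_box; case: (ltnP r n) => [lt_rn | le_nr]; last by rewrite nth_default ?sz_rows.
by rewrite -(nth_map _ 0%N) ?sz_rows // -/(shape _) sq nth_nseq lt_rn.
Qed.

Section Filling.
Variables (n : nat) (s : nat -> nat) (rows : seq (seq bool)).
Hypothesis st : stair n s.
Hypothesis box : forall r c, is_box rows r c = (r < n)%N && (c < n)%N.
Hypothesis le_rows : forall r c r' c', is_box rows r c -> (r' < r)%N -> (c' < c)%N ->
  is_plus rows r' c -> is_plus rows r c' -> is_plus rows r c.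
Hypothesis pipe_step : forall e f i, entry_edge n n e -> pipe rows e f ->
  step n s (exit_label n e) i -> exit_label n f = i.

(** Label [n] must be sent to 0, which forces a plus in the top right corner. By the Le-rule, any
    plus further left in row [r] then forces one at its end. A row with no plus at all would give a
    fixed point. *)
Lemma full_last_column r : (r < n)%N -> is_plus rows r n.-1.
Proof.
move=> lt_r; have [n_gt0 lt_n1] : (0 < n)%N /\ (n.-1 < n)%N by lia.
have plus0 : is_plus rows 0 n.-1.
  apply/negPn/negP => nplus; have [f p_f] := pipe_total box (Horiz 0 n.-1).
  have p1_f : pipe rows (Horiz 1 n.-1) f.
    apply/(pipe_south box f lt_n1 (leq0n 1) n_gt0); last by [].
    by case.
  have := exit_row p1_f (leqnn 1) n_gt0.
  suff -> : exit_label n f = 0%N by [].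
  apply: (pipe_step _ p_f) => /=; first lia.
  have -> : (n - n.-1.+1 + n = n)%N by lia.
  exact: step_first.
have [-> // | r_gt0] := posnP r.
have [/existsP [c plus_c] | /existsPn nplus] := boolP [exists c : 'I_n, is_plus rows r c].
  have [eq_c | neq_c] := eqVneq (val c) n.-1; first by rewrite -eq_c.
  apply: (le_rows (r' := 0) (c' := c)) => //; first by rewrite box lt_r.
  by have := ltn_ord c; move: neq_c => /=; lia.
have p_r : pipe rows (Vert r 0) (Vert r n).
  apply/(pipe_east box _ lt_r (leq0n n) (leqnn n)); last exact: exit_vert.
  by move=> c lt_c; apply: (nplus (Ordinal lt_c)).
have [|i _ st_i] := step_total (x := r) st; first lia.
have := pipe_step _ p_r st_i; rewrite /= lt_r => /(_ isT) eq_ri.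
by case: (step_neq st st_i).
Qed.

(** Induction from left to right. The pipe leaving with label [n + j] arrives from the west in row
    [s j]: at a level it comes from the plus of column [c - 1], otherwise straight along its row. So
    the bottom plus lies in row [s j]. A row [r] above it carries a pipe that leaves in row [r + 1],
    so [no_plus_of_exit] leaves no plus there. *)
Lemma column_filling c : (c < n.-1)%N ->
  forall r, (r < n)%N -> is_plus rows r c = (r == s (n - c.+1)).
Proof.
have [s_ge s_lt s_mono] := st; have [m] := ubnP c; elim: m c => // m IHm c le_cm lt_c.
have n_gt0 : (0 < n)%N by lia.
have [j [lt_j j_gt0 j_c]] : exists j, [/\ (j < n)%N, (0 < j)%N & (n - c.+1 = j)%N].
  by exists (n - c.+1)%N; split=> //; lia.
rewrite j_c; have lt_sj := s_lt _ lt_j.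
have to_column f : pipe rows (Vert (s j) c) f -> exit_label n f = (n + j)%N ->
    pipe rows (Vert (s j) c) (Horiz n c).
  move=> p_f f_j; have [| [r lt_r eq_f] | [c' lt_c' eq_f]] := exit_form box p_f.
  - by rewrite lt_sj; lia.
  - by move: f_j; rewrite eq_f /=; lia.
  by move: p_f; rewrite eq_f; suff -> : c' = c by []; move: f_j; rewrite eq_f /=; lia.
have /(exit_south_plus box lt_sj) : pipe rows (Vert (s j) c) (Horiz n c).
  have [/andP [lt_Sj /eqP lev] | nlev] := boolP ((j.+1 < n)%N && (s j.+1 == s j)).
    have [f p_f] := pipe_total box (Horiz 0 c.-1).
    have c_gt0 : (0 < c)%N by lia.
    have eq_j : (n - c.-1.+1 = j.+1)%N by lia.
    apply: (to_column f).
      rewrite -[c in Vert _ c]prednK //.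
      apply/pipe_elbow_east => //; [lia | by rewrite IHm ?eq_j ?lev //; lia |].
      apply/(pipe_south box f _ (leq0n _) (ltnW lt_sj)); [lia | | exact: p_f].
      by move=> r lt_r; rewrite IHm ?eq_j ?lev; lia.
    apply: (pipe_step _ p_f) => /=; first lia.
    have -> : (n - c.-1.+1 + n = n + j.+1)%N by lia.
    have -> : (n + j = (n + j.+1).-1)%N by lia.
    by apply: step_level => //; lia.
  have [f p_f] := pipe_total box (Vert (s j) 0).
  have desc : (j.+1 < n -> s j.+1 < s j)%N by have := s_mono j j.+1; lia.
  apply: (to_column f).
    apply/(pipe_east box f lt_sj (leq0n c)); [lia | | exact: p_f].
    move=> c' lt_c'; rewrite IHm; try lia.
    by have := s_mono j.+1 (n - c'.+1)%N; lia.
  apply: (pipe_step _ p_f) => /=; first by rewrite lt_sj.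
  exact: step_last.
case=> [|plus_j nplus r lt_r]; first lia.
case: (ltngtP r (s j)) => [lt_rj | lt_jr | -> //]; last by apply/negbTE/nplus; rewrite lt_jr.
apply/negbTE; have [/hitP hit_r | nhit] := boolP (hit n s 0 r); last first.
  have [f p_f] := pipe_total box (Vert r 0).
  apply: (no_plus_of_exit box full_last_column p_f erefl lt_r); last lia.
  apply: (pipe_step _ p_f) => /=; first by rewrite lt_r.
  by apply: step_free => // k lt_k s_k; case/hitP: nhit; exists k.
have exP : exists k, (k < n)%N && (s k == r).
  by case: hit_r => k [_ lt_k s_k]; exists k; rewrite lt_k s_k eqxx.
(* When [r] is attained, the pipe in question enters from the column of the first such [k], which is
   the rightmost column with its plus in row [r]. It lies left of [c] because [s] is decreasing. *)
case: (ex_minnP exP) => k /andP [lt_k /eqP s_k] k_min.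
have lt_jk : (j < k)%N by rewrite ltnNge; apply/negP => le_kj; have := s_mono _ _ le_kj lt_j; lia.
have desc : (s k < s k.-1)%N by have := s_mono k.-1 k; have := k_min k.-1; lia.
have [c' [lt_c' k_c']] : exists c', (c' < c)%N /\ (n - c'.+1 = k)%N.
  by exists (n - k.+1)%N; lia.
have [f p_f] := pipe_total box (Horiz 0 c').
have p_r : pipe rows (Vert r c'.+1) f.
  apply/(pipe_elbow_east box) => //; [lia | by rewrite IHm ?k_c' ?s_k ?eqxx //; lia |].
  apply/(pipe_south box f _ (leq0n r) (ltnW lt_r)); [lia | | exact: p_f].
  by move=> r' lt_r'; rewrite IHm ?k_c' ?s_k; lia.
apply: (no_plus_of_exit box full_last_column p_r erefl lt_r); last lia.
rewrite -{}s_k; apply: (pipe_step _ p_f) => /=; first lia.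
have -> : (n - c'.+1 + n = n + k)%N by lia.
by apply: step_descent => //; lia.
Qed.

End Filling.

Section FillingStep.
Variables (n : nat) (s : nat -> nat) (rows : seq (seq bool)).
Hypothesis st : stair n s.
Hypothesis box : forall r c, is_box rows r c = (r < n)%N && (c < n)%N.
Hypothesis plusE : forall r c, (r < n)%N -> (c < n)%N ->
  is_plus rows r c = (c == n.-1) || (r == s (n - c.+1)).

Lemma filling_step e f : entry_edge n n e -> pipe rows e f ->
  step n s (exit_label n e) (exit_label n f).
Proof.
move=> entry_e p_ef; have [s_ge s_lt s_mono] := st.
suff [f' p_ef' st_f'] : exists2 f', pipe rows e f' & step n s (exit_label n e) (exit_label n f').
  by rewrite (pipe_det p_ef p_ef').
case: e entry_e {p_ef} => [r _ /andP [lt_r /eqP ->] | r c /andP [/eqP -> lt_c]].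
  have lt_n1 : (n.-1 < n)%N by lia.
  (* The search starts at 1 because [j = 0] belongs to the full last column. The largest [j] found
     is the leftmost plus of row [r], where the pipe turns south for good. *)
  have [/hitP [j0 [j0_gt0 lt_j0 s_j0]] | nhit] := boolP (hit n s 1 r).
    pose P j := (j < n)%N && (s j == r).
    have exP : exists j, P j by exists j0; rewrite /P lt_j0 s_j0 eqxx.
    have leP j : P j -> (j <= n)%N by rewrite /P; lia.
    case: (ex_maxnP exP leP) => j /andP [lt_j /eqP s_j] j_max.
    have le_j0 : (j0 <= j)%N by apply: j_max; rewrite /P lt_j0 s_j0 eqxx.
    have [c [lt_c c_j]] : exists c, (c < n.-1)%N /\ (n - c.+1 = j)%N.
      by exists (n - j.+1)%N; lia.
    exists (Horiz n c).
      apply/(pipe_east box _ lt_r (leq0n c)); [lia | |].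
        move=> c' lt_c'; rewrite plusE; try lia.
        by have := j_max (n - c'.+1)%N; rewrite /P; lia.
      apply/(pipe_elbow_south box _ lt_r); [lia | by rewrite plusE ?c_j ?s_j ?eqxx ?orbT //; lia |].
      apply/(pipe_south box _ _ lt_r (leqnn n)); [lia | | exact: exit_horiz].
      by move=> r' r'_bnd; rewrite plusE ?c_j ?s_j; lia.
    rewrite /= c_j addnC -s_j; apply: step_last => // lt_Sj.
    by have := j_max j.+1; have := s_mono j j.+1; rewrite /P; lia.
  have nplus c : (c < n.-1)%N -> ~~ is_plus rows r c.
    move=> lt_c; rewrite plusE //; last lia.
    apply/norP; split; first lia.
    by apply: contra nhit => /eqP ->; apply/hitP; exists (n - c.+1)%N; split=> //; lia.
  have to_last f' : pipe rows (Horiz r.+1 n.-1) f' -> pipe rows (Vert r 0) f'.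
    move=> p_f'; apply/(pipe_east box _ lt_r (leq0n n.-1)); first lia.
      by move=> c'' lt_c''; apply: nplus.
    by apply/(pipe_elbow_south box _ lt_r lt_n1); rewrite ?plusE ?eqxx.
  have s0 : s 0%N = n.-1 by have := s_ge 0%N; have := s_lt 0%N; lia.
  have [lt_Sr | ge_Sr] := ltnP r.+1 n.
    exists (Vert r.+1 n).
      apply: to_last; rewrite -[X in Vert _ X](ltn_predK lt_r).
      apply/(pipe_elbow_east box _ lt_Sr lt_n1); rewrite ?plusE ?eqxx //.
      by rewrite (ltn_predK lt_r); apply: exit_vert.
    rewrite /=; apply: step_free => // j lt_j s_j; have [j0 | j_gt0] := posnP j.
      by move: s_j; rewrite j0 s0; lia.
    by case/hitP: nhit; exists j.
  have eq_r : r = s 0%N by lia.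
  exists (Horiz n n.-1).
    by apply: to_last; have -> : r.+1 = n by [lia]; apply: exit_horiz.
  rewrite /= (_ : n - n.-1.+1 + n = n + 0)%N; last lia.
  rewrite {1}eq_r; apply: step_last => [|lt_1]; first lia.
  have := s_mono 0%N 1%N isT lt_1; rewrite leq_eqVlt => /predU1P [eq_1 | //].
  by case/hitP: nhit; exists 1%N; split=> //; lia.
have n_gt0 : (0 < n)%N by lia.
have lt_n1 : (n.-1 < n)%N by lia.
have nE : n.-1.+1 = n by lia.
have [eq_c | neq_c] := eqVneq c n.-1.
  exists (Vert 0 n).
    rewrite eq_c -[X in Vert _ X]nE.
    apply/(pipe_elbow_east box _ n_gt0 lt_n1); rewrite ?plusE ?eqxx //.
    by rewrite nE; apply: exit_vert.
  by rewrite /= eq_c nE subnn; apply: step_first.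
have [j [lt_j j_gt0 j_c]] : exists j, [/\ (j < n)%N, (0 < j)%N & (n - c.+1 = j)%N].
  by exists (n - c.+1)%N; split=> //; lia.
have lt_sj := s_lt _ lt_j.
have to_elbow f' : pipe rows (Vert (s j) c.+1) f' -> pipe rows (Horiz 0 c) f'.
  move=> p_f'; apply/(pipe_south box _ lt_c (leq0n (s j))); first lia.
    by move=> r' lt_r'; rewrite plusE ?j_c; lia.
  by apply/(pipe_elbow_east box _ lt_sj lt_c); rewrite ?plusE ?j_c ?eqxx ?orbT.
(* The pipe falls to row [s j] and turns east. At a level it meets the plus of column [c + 1] and
   goes down; at a descent it runs to the last column and leaves one row lower. *)
have [lev | nlev] := eqVneq (s j) (s j.-1).
  have c1_j : (n - c.+2 = j.-1)%N by lia.
  have lt_c1 : (c.+1 < n)%N by lia.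
  exists (Horiz n c.+1).
    apply: to_elbow; apply/(pipe_elbow_south box _ lt_sj lt_c1).
      by rewrite plusE // c1_j lev eqxx orbT.
    apply/(pipe_south box _ lt_c1 lt_sj (leqnn n)); last exact: exit_horiz.
    move=> r' r'_bnd; rewrite plusE ?c1_j //; last lia.
    have [eq_c1 /= | _ /=] := eqVneq c.+1 n.-1; last lia.
    have j1 : j.-1 = 0%N by lia.
    by move: r'_bnd; rewrite lev j1; have := s_ge 0%N; lia.
  rewrite /= j_c c1_j (addnC j) (_ : j.-1 + n = (n + j).-1)%N; last lia.
  by apply: step_level => //; lia.
have desc : (s j < s j.-1)%N by have := s_mono j.-1 j; lia.
have lt_Ssj : ((s j).+1 < n)%N by have := s_lt j.-1; lia.
exists (Vert (s j).+1 n).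
  apply: to_elbow; apply/(pipe_east box (c' := n.-1) _ lt_sj); [lia | lia | |].
    move=> c' c'_bnd; rewrite plusE; try lia.
    by have := s_mono (n - c'.+1)%N j.-1; lia.
  apply/(pipe_elbow_south box _ lt_sj lt_n1); first by rewrite plusE ?eqxx.
  rewrite -[X in Vert _ X]nE.
  apply/(pipe_elbow_east box _ lt_Ssj lt_n1); rewrite ?plusE ?eqxx //.
  by rewrite nE; apply: exit_vert.
by rewrite /= j_c addnC; apply: step_descent; rewrite ?j_gt0.
Qed.

End FillingStep.

(** * The shape is forced to be the square *)

Lemma nth_shape (rows : seq (seq bool)) r : nth 0%N (shape rows) r = size (nth [::] rows r).
Proof.
have [lt_r | ge_r] := ltnP r (size rows); first exact: nth_map.
by rewrite !nth_default ?size_map.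
Qed.

(** Conjugation of partitions: the count is a column length of the Young diagram. *)
Lemma sorted_geq_nth_gt (w : seq nat) m r : sorted geq w ->
  (m < nth 0%N w r)%N = (r < count (fun x => m < x)%N w)%N.
Proof.
elim: w r => [|x w IHw] r /=; first by rewrite nth_nil.
move=> path_w; have sorted_w := path_sorted path_w.
have geq_trans : transitive geq by move=> b a c /= le_ba /leq_trans; apply.
have /allP w_le := order_path_min geq_trans path_w.
have [lt_mx | le_xm] := ltnP m x; first by case: r => [|r] /=; rewrite ?lt_mx // IHw.
have -> : count (fun x => m < x)%N w = 0%N.
  apply/eqP; rewrite -leqn0 leqNgt -has_count; apply/hasP => -[y /w_le /= le_yx].
  by rewrite ltnNge (leq_trans le_yx).
rewrite ltn0; apply/negbTE; rewrite -leqNgt; case: r => [//|r] /=.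
have [lt_r | ge_r] := ltnP r (size w); last by rewrite nth_default.
by apply: leq_trans le_xm; apply: w_le; apply: mem_nth.
Qed.

(** If only [t < n] rows have full length, the last column has label [t]. The pipe entering there
    either reaches its foot, giving a fixed point, or turns east in one of these rows and leaves
    with a label below [t]. Both contradict [step_exceedance]. *)
Lemma square_of_dperm n s (L : le_diagram n n) (p : decorated_perm (n + n)) :
  stair n s -> le_dperm L p -> (forall x i : 'I_(n + n), step n s x i -> p x = i) ->
  square_shape L.
Proof.
move=> st Lp pP; have size_L : size L = n by rewrite size_tuple.
pose t := count (fun row => n.-1 < size row)%N L.
have fullE r : (n.-1 < size (nth [::] L r))%N = (r < t)%N.
  by rewrite -nth_shape sorted_geq_nth_gt ?le_young // count_map.
have le_tn : (t <= n)%N by rewrite -[X in (_ <= X)%N]size_L count_size.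
have [eq_tn | neq_tn] := eqVneq t n.
  apply: (@eq_from_nth _ 0%N); rewrite size_map ?size_nseq ?size_L // => r lt_r.
  rewrite nth_shape nth_nseq lt_r; apply/eqP.
  by rewrite eqn_leq le_fits -[X in (X <= _)%N](ltn_predK lt_r) fullE eq_tn.
have lt_tn : (t < n)%N by rewrite ltn_neqAle neq_tn.
have n_n1 : (n - n.-1.+1 = 0)%N by lia.
have exits k r : (r + k = t)%N ->
    exists2 f, pipe L (Horiz r n.-1) f & (edge_label n L f <= t)%N.
  elim: k r => [|k IHk] r eq_t.
    exists (Horiz r n.-1); last by rewrite /= n_n1 add0n leqnn.
    by apply: pipe_exit; rewrite /= /is_box fullE -eq_t addn0 ltnn.
  have in_r : edge_in L (Horiz r n.-1) by rewrite /= /is_box fullE; lia.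
  have [plus_r | nplus_r] := boolP (is_plus L r n.-1); last first.
    have [|f p_f le_f] := IHk r.+1; first lia.
    by exists f => //; apply: pipe_box => //=; rewrite (negbTE nplus_r).
  have size_r : size (nth [::] L r) = n.
    by apply/eqP; rewrite eqn_leq le_fits -[X in (X <= _)%N](ltn_predK lt_tn) fullE; lia.
  exists (Vert r n); last by rewrite /= size_r; lia.
  apply: pipe_box => //=; rewrite plus_r (ltn_predK lt_tn).
  by apply: pipe_exit; rewrite /= /is_box size_r ltnn.
have [f p_f le_f] := exits t 0%N (add0n t).
have lt_t : (t < n + n)%N by lia.
have lt_f : (edge_label n L f < n + n)%N by lia.
have [|i lt_i st_i] := step_total (x := t) st; first lia.
have [|||p_t _] := Lp _ _ (Ordinal lt_t) (Ordinal lt_f) _ p_f.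
- by rewrite /= ltn_predL; lia.
- by rewrite /= n_n1.
- by [].
have := pP (Ordinal lt_t) (Ordinal lt_i) st_i; rewrite p_t => /(congr1 val) /= eq_i.
have := step_exceedance st st_i lt_tn; lia.
Qed.

(** * Dyck paths *)

Lemma horizontal_step_rcons w b h c : horizontal_step (rcons w b) h c <->
  horizontal_step w h c \/ [/\ b, h = count negb w & c = count id w].
Proof.
split=> [[k [nth_k eq_h eq_c]] | [[k [nth_k eq_h eq_c]] | [b_true -> ->]]].
- move: nth_k eq_h eq_c; rewrite nth_rcons -cats1 take_cat; case: ltngtP => // [lt_k | ->].
    by left; exists k.
  by rewrite subnn take0 cats0 => -> <- <-; right.
- have lt_k : (k < size w)%N by rewrite ltnNge; apply/negP => ge_k; rewrite nth_default in nth_k.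
  by exists k; rewrite nth_rcons -cats1 take_cat lt_k.
- exists (size w); rewrite nth_rcons ltnn eqxx -cats1 take_cat ltnn subnn take0 cats0.
  by split.
Qed.

Definition below_diagonal w : Prop :=
  forall k, (count id (take k w) <= count negb (take k w))%N.

Lemma below_diagonal_rcons w b : below_diagonal w ->
  (count id (rcons w b) <= count negb (rcons w b))%N -> below_diagonal (rcons w b).
Proof.
move=> below_w le_w k; have [le_k | lt_k] := leqP k (size w).
  by rewrite -cats1 takel_cat.
by rewrite take_oversize // size_rcons.
Qed.

Definition south_then_east w d := rcons (iter d (rcons^~ false) w) true.

Lemma count_iter_south p w d :
  count p (iter d (rcons^~ false) w) = (count p w + d * p false)%N.
Proof.
elim: d => [|d IHd] /=; first by rewrite addn0.
by rewrite -cats1 count_cat IHd /= mulSn addn0; lia.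
Qed.

Lemma south_then_eastP w d : below_diagonal w -> (count id w < count negb w + d)%N ->
  below_diagonal (south_then_east w d) /\
  forall h c, horizontal_step (south_then_east w d) h c <->
    horizontal_step w h c \/ h = (count negb w + d)%N /\ c = count id w.
Proof.
move=> below_w lt_w; split=> [|h c].
  apply: below_diagonal_rcons; last first.
    by rewrite -cats1 !count_cat !count_iter_south /=; lia.
  elim: d {lt_w} => //= d IHd; apply: below_diagonal_rcons => //.
  rewrite -cats1 !count_cat /= !addn0; have := IHd (size (iter d (rcons^~ false) w)).
  by rewrite take_size; lia.
rewrite /south_then_east horizontal_step_rcons !count_iter_south muln1 muln0 addn0.
have -> : horizontal_step (iter d (rcons^~ false) w) h c <-> horizontal_step w h c.
  elim: d {lt_w} => //= d IHd; rewrite horizontal_step_rcons IHd.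
  by split=> [[//|[]//]|]; left.
by split=> [[|[_ -> ->]]|[|[-> ->]]]; by [left | right].
Qed.

Fixpoint staircase_path (H : nat -> nat) m :=
  if m is m'.+1 then
    south_then_east (staircase_path H m')
                    (H m' - (if m' is k.+1 then H k else 0))
  else [::].

Lemma staircase_pathP n (H : nat -> nat) :
  (forall c, c < n -> c < H c)%N -> (forall c, c.+1 < n -> H c <= H c.+1)%N ->
  forall m, (m <= n)%N ->
  [/\ count id (staircase_path H m) = m,
      count negb (staircase_path H m) = (if m is k.+1 then H k else 0%N),
      below_diagonal (staircase_path H m)
    & forall h c, horizontal_step (staircase_path H m) h c <->
                  (c < m)%N /\ h = H c].
Proof.
move=> H_gt H_mono; elim=> [|m IHm] lt_mn.
  split=> // h c; split=> [[k []]|[]//].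
  by rewrite nth_nil.
have [id_m negb_m below_m step_m] := IHm (ltnW lt_mn).
pose d := (H m - (if m is k.+1 then H k else 0))%N.
have negb_d : (count negb (staircase_path H m) + d = H m)%N.
  rewrite negb_m /d; case: m lt_mn {IHm id_m negb_m below_m step_m d} => [|m] lt_mn.
    by rewrite subn0.
  by rewrite subnKC // H_mono.
have [|below_Sm step_Sm] := south_then_eastP (d := d) below_m.
  by rewrite negb_d id_m H_gt.
split=> //=.
- by rewrite /south_then_east -cats1 count_cat count_iter_south id_m /= muln0 addn0 addn1.
- by rewrite /south_then_east -cats1 count_cat count_iter_south /= muln1 !addn0 -/d negb_d.
move=> h c; rewrite step_Sm step_m -/d negb_d id_m; split=> [[[lt_c ->]|[-> ->]]|[]].
- by split=> //; apply: ltnW.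
- by [].
rewrite ltnS leq_eqVlt => /predU1P [-> -> | lt_c ->]; by [right | left].
Qed.

Lemma count_nth_iota (T : Type) (x0 : T) a (w : seq T) :
  count a w = count (fun r => a (nth x0 w r)) (iota 0 (size w)).
Proof. by rewrite -[in LHS](mkseq_nth x0 w) count_map. Qed.

Section Dyck.
Variables (n : nat) (L : le_diagram n n).
Hypothesis sq : square_shape L.

Definition stair_filling s := forall r c, (r < n)%N -> (c < n)%N ->
  is_plus L r c = (c == n.-1) || (r == s (n - c.+1)%N).

Lemma plus_bounds r c : is_plus L r c -> (r < n)%N /\ (c < n)%N.
Proof.
rewrite /is_plus => plus_rc; have lt_c : (c < size (nth [::] L r))%N.
  by rewrite ltnNge; apply/negP => ge_c; rewrite nth_default in plus_rc.
have : is_box L r c by [].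
by rewrite (shape_square_box sq) => /andP.
Qed.

Lemma column_count c : count (fun row => nth false row c) L =
  count (fun r => is_plus L r c) (iota 0 n).
Proof. by rewrite (count_nth_iota [::]) size_tuple. Qed.

Lemma stair_conditions s : stair n s -> stair_filling s ->
  column_condition L /\ dyck_condition L.
Proof.
case=> s_ge s_lt s_mono fillE; split=> [c lt_c | ].
  rewrite column_count (eq_in_count (a2 := fun r => (c == n.-1) || (r == s (n - c.+1)%N))).
    have [-> | neq_c] := eqVneq c n.-1.
      have -> : (n.-1.+1 == n)%N by lia.
      by rewrite /= (eq_count (a2 := predT)) // count_predT size_iota.
    have -> : (c.+1 == n)%N = false by lia.
    rewrite /= (eq_count (a2 := pred1 (s (n - c.+1)%N))) //.
    have lt_s : (s (n - c.+1) < n)%N by apply: s_lt; lia.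
    by rewrite (count_uniq_mem _ (iota_uniq _ _)) mem_iota lt_s.
  by move=> r; rewrite mem_iota => lt_r; apply: fillE; lia.
have [||id_n negb_n below_n step_n] :=
    @staircase_pathP n (fun c => (s (n - c.+1)%N).+1) _ _ n (leqnn n).
- by move=> c lt_c; have := s_ge (n - c.+1)%N; lia.
- by move=> c lt_c; have := s_mono (n - c.+2)%N (n - c.+1)%N; lia.
exists (staircase_path (fun c => (s (n - c.+1)%N).+1) n).
  (* The path ends on the bottom side because the last column has depth [s 0 + 1 = n]. *)
  split=> //; rewrite -(count_predC id) id_n (negb_n : count (predC id) _ = _) mul2n -addnn.
  congr addn; case: {+}n s_ge s_lt => // m s_ge s_lt.
  by rewrite subnn; have := s_ge 0%N; have := s_lt 0%N; lia.
move=> h c; rewrite step_n; split=> [[lt_c ->] | [r -> [plus_rc nplus]]].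
  exists (s (n - c.+1)%N) => //.
  have lt_s : (s (n - c.+1) < n)%N by apply: s_lt; lia.
  split=> [|r lt_r]; first by rewrite fillE // eqxx orbT.
  apply/negP => plus_r; have [lt_rn _] := plus_bounds plus_r.
  move: plus_r; rewrite fillE // => /orP [/eqP eq_c | ]; last by lia.
  move: lt_r; rewrite eq_c; have -> : (n - n.-1.+1 = 0)%N by lia.
  by have := s_ge 0%N; lia.
have [lt_r lt_c] := plus_bounds plus_rc; split=> //; congr S.
move: plus_rc; rewrite fillE // => /orP [/eqP eq_c | /eqP //].
have -> : (n - c.+1 = 0)%N by lia.
apply/eqP; rewrite eqn_leq; apply/andP; split; first by have := s_ge 0%N; lia.
have lt_s0 : (s 0 < n)%N by apply: s_lt; lia.
by rewrite leqNgt; apply/negP => /nplus; rewrite fillE // eq_c eqxx.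
Qed.

Lemma conditions_stair : column_condition L -> dyck_condition L ->
  exists2 s, stair n s & stair_filling s.
Proof.
move=> col [w [_ _ below_w] stepE].
(* The bottom plus of each column: in the full last one it is in row [n - 1], elsewhere it is the
   only plus. *)
pose rr c := if c == n.-1 then n.-1 else find (fun row => nth false row c) L.
have last_plus r : (r < n)%N -> is_plus L r n.-1.
  move=> lt_r; have := col n.-1; rewrite (ltn_predK lt_r) eqxx => /(_ (leqnn n)).
  move/eqP; rewrite -[X in _ == X](size_tuple L) -all_count => /all_nthP; apply.
  by rewrite size_tuple.
have rrE r c : (r < n)%N -> (c < n.-1)%N -> is_plus L r c = (r == rr c).
  move=> lt_r lt_c; rewrite /rr (ltn_eqF lt_c).
  have := col c; have -> : (c.+1 == n)%N = false by lia.
  move=> /(_ ltac:(lia)) count1.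
  have has1 : has (fun row => nth false row c) L by rewrite has_count count1.
  have plus_f : is_plus L (find (fun row => nth false row c) L) c by exact: (nth_find [::] has1).
  have lt_f := has1; rewrite has_find size_tuple in lt_f.
  apply/idP/eqP => [plus_r | -> //].
  apply/eqP/negPn/negP => neq_r.
  have two : uniq [:: r; find (fun row => nth false row c) L] by rewrite /= inE neq_r.
  have sub2 : {subset [:: r; find (fun row => nth false row c) L] <=
      [seq i <- iota 0 n | is_plus L i c]}.
    by move=> i; rewrite !inE mem_filter mem_iota => /orP [/eqP -> | /eqP ->];
       rewrite ?plus_r ?plus_f /= ?lt_r ?lt_f.
  by have := uniq_leq_size two sub2; rewrite size_filter -column_count count1.
have rr_lt c : (c < n)%N -> (rr c < n)%N.
  rewrite /rr => lt_c; case: eqP => [_ | neq_c]; first lia.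
  have := col c lt_c; rewrite ifF; last lia.
  by move=> count1; rewrite -[X in (_ < X)%N](size_tuple L) -has_find has_count count1.
have rr_bottom c : (c < n)%N -> bottom_plus L (rr c) c.
  move=> lt_c; have lt_rr := rr_lt c lt_c; have [eq_c | neq_c] := eqVneq c n.-1.
    rewrite eq_c /rr eqxx; split; first by apply: last_plus; lia.
    by move=> r' lt_r'; apply/negP => /plus_bounds [] ; lia.
  split=> [|r' lt_r']; first by rewrite rrE ?eqxx //; lia.
  apply/negP => plus_r'; have [lt_r'n _] := plus_bounds plus_r'.
  by move: plus_r'; rewrite rrE //; lia.
have rr_step c : (c < n)%N -> horizontal_step w (rr c).+1 c.
  by move=> lt_c; apply/stepE; exists (rr c) => //; apply: rr_bottom.
have rr_ge c : (c < n)%N -> (c <= rr c)%N.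
  (* The prefix of length [k + 1] includes the east step itself: it has [c + 1] east and [rr c + 1]
     south steps. *)
  move=> /rr_step [k [nth_k negb_k id_k]]; have := below_w k.+1.
  have lt_k : (k < size w)%N by rewrite ltnNge; apply/negP => ge_k; rewrite nth_default in nth_k.
  by rewrite (take_nth false lt_k) nth_k -cats1 !count_cat negb_k id_k /=; lia.
have rr_mono c c' : (c <= c')%N -> (c' < n)%N -> (rr c <= rr c')%N.
  move=> le_cc lt_c'; have [-> // | neq_cc] := eqVneq c c'.
  have [k [_ negb_k id_k]] := rr_step c (leq_ltn_trans le_cc lt_c').
  have [k' [_ negb_k' id_k']] := rr_step c' lt_c'.
  have le_kk p : (k <= k')%N -> (count p (take k w) <= count p (take k' w))%N.
    by move=> le_k; rewrite -(subnKC le_k) takeD count_cat leq_addr.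
  have [/le_kk | lt_k'] := leqP k k'; first by move/(_ negb); rewrite negb_k negb_k'.
  have : (count id (take k' w) <= count id (take k w))%N.
    by rewrite -(subnKC (ltnW lt_k')) takeD count_cat leq_addr.
  by rewrite id_k id_k'; move: neq_cc; lia.
exists (fun j => rr (n - j.+1)%N).
  split=> [j lt_j | j lt_j | j j' le_j lt_j'].
  - by have := rr_ge (n - j.+1)%N; lia.
  - by apply: rr_lt; lia.
  - by apply: rr_mono; lia.
move=> r c lt_r lt_c; have [-> | neq_c] := eqVneq c n.-1; first by rewrite last_plus.
by rewrite rrE //; [congr (_ == rr _) |]; lia.
Qed.

End Dyck.

(** * Boundary labels of the square and the equivalence *)

Lemma edge_label_square n (L : le_diagram n n) e : square_shape L ->
  match e with Vert r _ => (r < n)%N | Horiz _ c => (c < n)%N end ->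
  edge_label n L e = exit_label n e.
Proof.
move=> sq; case: e => [r c lt_r | r c lt_c] /=.
  by rewrite -nth_shape sq nth_nseq lt_r subnn addn0.
have -> : count (fun row => c < size row)%N L = count (fun k => c < k)%N (shape L).
  by rewrite count_map.
by rewrite sq count_nseq lt_c mul1n.
Qed.

Lemma entry_exit_labels n (L : le_diagram n n) e f : square_shape L ->
  entry_edge n n e -> pipe L e f ->
  [/\ edge_label n L e = exit_label n e, edge_label n L f = exit_label n f,
      (exit_label n e < n + n)%N & (exit_label n f < n + n)%N].
Proof.
move=> sq entry_e p_ef; have box := shape_square_box sq.
rewrite !edge_label_square //.
- split=> //; first by case: e entry_e {p_ef} => r c /=; lia.
  have [|[r lt_r ->]|[c lt_c ->]] := exit_form box p_ef; last 2 first.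
  + by rewrite /=; lia.
  + by rewrite /=; lia.
  by case: e entry_e {p_ef} => r c /=; lia.
- have [|[r lt_r ->]|[c lt_c ->]] := exit_form box p_ef => //.
  by case: e entry_e {p_ef} => r c /=; lia.
- by case: e entry_e {p_ef} => r c /=; lia.
Qed.

Lemma le_dperm_filling n s (L : le_diagram n n) (p : decorated_perm (n + n)) :
  stair n s -> le_dperm L p -> (forall x i : 'I_(n + n), step n s x i -> p x = i) ->
  square_shape L /\ stair_filling L s.
Proof.
move=> st Lp pP; have sq := square_of_dperm st Lp pP; split=> //.
have box := shape_square_box sq.
have pipe_step e f i : entry_edge n n e -> pipe L e f ->
    step n s (exit_label n e) i -> exit_label n f = i.
  move=> entry_e p_ef st_i; have [lab_e lab_f lt_e lt_f] := entry_exit_labels sq entry_e p_ef.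
  have [i' lt_i' st_i'] := step_total st lt_e.
  have [p_e _] := Lp e f (Ordinal lt_e) (Ordinal lt_f) entry_e p_ef lab_e lab_f.
  have := pP (Ordinal lt_e) (Ordinal lt_i') st_i'; rewrite p_e => /(congr1 val) /= ->.
  exact: step_fun st st_i' st_i.
move=> r c lt_r lt_c; have [-> | neq_c] := eqVneq c n.-1.
  exact: full_last_column st box (@le_rule _ _ L) pipe_step _ lt_r.
by apply: (column_filling st box (@le_rule _ _ L) pipe_step); lia.
Qed.

Lemma filling_le_dperm n s (L : le_diagram n n) (p : decorated_perm (n + n)) :
  stair n s -> square_shape L -> stair_filling L s ->
  (forall x i : 'I_(n + n), step n s x i -> p x = i) -> le_dperm L p.
Proof.
move=> st sq fillE pP e f i j entry_e p_ef.
have [-> -> lt_e lt_f] := entry_exit_labels sq entry_e p_ef => eq_i eq_j.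
have := filling_step st (shape_square_box sq) fillE entry_e p_ef; rewrite eq_i eq_j => st_ij.
(* The marking clause is vacuous, since there are no fixed points. *)
split=> [|eq_ij]; first exact: pP.
by case: (step_neq st st_ij); rewrite eq_ij.
Qed.

Theorem theorem6p4 (R : realFieldType) (n : nat) (L : le_diagram n n) :
  (exists2 M : {set {set 'I_(n + n)}},
     unit_interval_positroid R M & parameterizes R L M) <->
  [/\ square_shape L, column_condition L & dyck_condition L].
Proof.
split=> [[M /unit_interval_positroidP [s st ->] [_ [p Lp Mp]]] | [sq col dyck]].
  have [sq fillE] := le_dperm_filling st Lp ((matroid_dperm_stair R p st).1 Mp).
  by have [] := stair_conditions sq st fillE.
have [s st fillE] := conditions_stair sq col dyck; have [q qP] := stair_perm st.
have fixed0 j : j \in set0 -> q j = j by rewrite inE.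
pose p := DecoratedPerm fixed0.
exists (column_matroid (stair_matrix R n s)).
  by apply/unit_interval_positroidP; exists s.
split; first exact: stair_matrix_positroid.
exists p; first exact: (@filling_le_dperm n s L p).
exact/(matroid_dperm_stair R p st).
Qed.
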